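(* Let $p$ be a prime and let $G$ be a non-abelian finite $p$-group such that $G/Z(G)$ is powerful. (i) If either $p>2$ or $Z(G)$ is not cyclic, then $\mathrm{Aut}(G)$ contains a noninner automorphism $\alpha$ of order $p$ leaving $\Phi(G)$ elementwise fixed (that is, $x^\alpha=x$ for all $x\in\Phi(G)$). (ii) If $p=2$, then $\mathrm{Aut}(G)$ contains a noninner automorphism of order $2$ leaving either $\Phi(G)$ or $\Omega_1(Z(G))$ elementwise fixed. Moreover, (iii) there exists a finite powerful $2$-group $G$ of nilpotency class $2$ such that every automorphism of $G$ of order $2$ leaving $\Phi(G)$ elementwise fixed is an inner automorphism of $G$.
   Context: $Z(G)$ denotes the center, $\Phi(G)$ the Frattini subgroup, $\mathrm{Aut}(G)$ the automorphism group of $G$. For a $p$-group $P$, $\Omega_1(P)$ is the subgroup generated by the elements of order $p$ of $P$. A finite $p$-group $P$ is powerful if $P'\le P^p$ when $p$ is odd, and $P'\le P^4$ when $p=2$, where $P'$ is the derived subgroup and $P^m$ is the subgroup generated by all $m$-th powers of elements of $P$. *)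

(* Defs.v *)
From mathcomp Require Import all_boot all_fingroup all_solvable.

Set Implicit Arguments.
Unset Strict Implicit.
Unset Printing Implicit Defensive.

Import GroupScope.

(* Unlike 'Mho^n(A), this takes m-th powers for a literal exponent m. *)
Definition power_subgroup (gT : finGroupType) (m : nat) (A : {set gT}) :
  {set gT} := <<[set x ^+ m | x in A]>>.

Definition powerful (gT : finGroupType) (p : nat) (A : {set gT}) : bool :=
  p.-group A && (A^`(1) \subset power_subgroup (if p == 2 then 4 else p) A).

Definition Inn (gT : finGroupType) (G : {group gT}) : {set {perm gT}} :=
  conj_aut G @* G.

Definition fixes_elementwise (gT : finGroupType) (a : {perm gT})
  (A : {set gT}) : Prop := {in A, forall x, a x = x}.

(* Main.v *)
Require Import Defs.
From mathcomp Require Import all_boot all_fingroup all_solvable all_algebra.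

Set Implicit Arguments.
Unset Strict Implicit.
Unset Printing Implicit Defensive.

Import GroupScope.

(** Write Z for the centre of G, H = G / Z, and call the automorphisms of order
    p that fix Phi(G) elementwise the test automorphisms.  Suppose that all of
    them are inner.

    A central element z of order p and a maximal subgroup M containing z give
    the test automorphism that fixes M and sends g to g * z, for some g outside
    M.  It is conjugation by some h with C_G(h) = M and [G, h] inside <z>
    (maximal_cent1).  So if W is the preimage of the centre of G / <z>, the
    intersection C_G(W) lies in all the maximal subgroups; as each element of W
    has at most p conjugates, this forces |W : Z| >= |G : Phi(G)|
    (leq_index_Phi).  Now W / Z is a central elementary abelian subgroup of H,
    while in a powerful group H a subgroup of exponent p has order at most
    |H : Phi(H)| (powerful_exponent_bound).  Hence equality holds, with three
    consequences: two independent choices of z are impossible, so Z is cyclic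
    (center_cyclic); every g in G with g ^ p in Z lies in W (root_center_mod);
    and therefore an automorphism of order p sending some g to g * y, with y
    not central, is never inner (noncentral_shift_noninner): it would be
    conjugation by an element whose p-th power is central, that is, by an
    element of W, and such conjugations move g by central elements.

    It remains to write down such an automorphism.  If p is odd, take a
    noncentral y of order p in W; g |-> g * y, fixing the maximal subgroup
    C_G(y), is a test automorphism because (g * y) ^ p = g ^ p, and this is the
    contradiction wanted (frattini_inner_even).  If p = 2 the extra term
    [y, g] of (g * y) ^ 2 does not vanish.  It does in (g * y) ^ 4, and if W is
    abelian there is a normal subgroup K of C_G(y), with G / K cyclic of order
    4 generated by g, that can be fixed instead of C_G(y)
    (abelian_center_mod_aut); the powerful structure of H is what provides K.
    If W is not abelian, G is a central product over Z of C_G(W1) and a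
    subgroup W1 of W with W1 / Z of order 4, and an automorphism of order 2 of
    W1 is extended by the identity on C_G(W1) (nonabelian_center_mod_aut).
    These automorphisms need not fix Phi(G), but when Z is cyclic every
    automorphism fixes the subgroup of order 2 of Z.

    For (iii), the group <x, y | x^16 = y^4 = 1, x^y = x^5> of order 64 has few
    enough candidates for the images of x and y to examine all of them. *)

(** * Powers in powerfully embedded subgroups *)

(** With this exponent, 'Mho^(power_depth p) is generated by the fourth powers
    if p = 2 and by the p-th powers otherwise, so that the two cases in the
    definition of powerful groups can be treated together. *)
Definition power_depth (p : nat) := (p == 2).+1.

Lemma power_subgroup_Mho (gT : finGroupType) (p : nat) (A : {group gT}) :
  p.-group A ->
  power_subgroup (if p == 2 then 4 else p) A = 'Mho^(power_depth p)(A).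
Proof.
move=> pA; rewrite (MhoE _ pA) /power_depth /power_subgroup.
by case: eqP => [->|_]; rewrite ?expn1.
Qed.

Lemma Mho_depth_sub (gT : finGroupType) (p : nat) (A : {group gT}) :
  'Mho^(power_depth p)(A) \subset 'Mho^1(A).
Proof. by apply: Mho_leq. Qed.

Lemma Mho2_sub_Mho11 (gT : finGroupType) (A : {group gT}) (p : nat) : p.-group A ->
  'Mho^2(A) \subset 'Mho^1('Mho^1(A)).
Proof.
move=> pA; rewrite (MhoE _ pA) gen_subG; apply/subsetP=> _ /imsetP[x Ax ->].
rewrite (_ : (p ^ 2)%N = (p ^ 1 * p ^ 1)%N) // expgM.
have px := mem_p_elt pA Ax.
by rewrite !Mho_p_elt // ?mem_p_elt // p_eltX.
Qed.

Lemma Mho_mem_power (gT : finGroupType) (p : nat) (A : {group gT}) x n :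
  p.-group A -> x \in A -> x ^+ (p ^ n) \in 'Mho^n(A).
Proof. by move=> pA Ax; rewrite Mho_p_elt // (mem_p_elt pA). Qed.

Lemma odd_prime_dvd_bin2 p : prime p -> p != 2 -> p %| 'C(p, 2).
Proof.
by move=> pr_p p2; apply: prime_dvd_bin => //=; rewrite ltn_neqAle eq_sym p2 prime_gt1.
Qed.

(** The core of the proof that powerful embedding passes from N to Mho^1(N),
    after factoring out everything that is to be shown negligible: then
    [x ^ n, g] = [x, g] ^ n * [x, g, x] ^ (n choose 2) for x in N, with
    [x, g, x] central. *)
Section CentralPowers.
Variables (gT : finGroupType) (p : nat) (N H : {group gT}).
Hypotheses (pr_p : prime p) (pH : p.-group H) (nNH : N <| H).
Hypothesis embN : [~: N, H] \subset 'Mho^(power_depth p)(N).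
Hypothesis MhoMho1 : 'Mho^(power_depth p)('Mho^1(N)) = 1.
Hypothesis cRH : [~: 'Mho^1(N), H, H] = 1.

Let sNH : N \subset H. Proof. exact: normal_sub. Qed.
Let pN : p.-group N. Proof. exact: pgroupS pH. Qed.
Let sMN : 'Mho^1(N) \subset N. Proof. exact: Mho_sub. Qed.
Let pM : p.-group 'Mho^1(N). Proof. exact: pgroupS pN. Qed.

Let central_comm u g h : u \in 'Mho^1(N) -> g \in H -> h \in H ->
  commute h [~ u, g].
Proof.
move=> Mu Hg Hh; move/commG1P/centsP: cRH => cRH'.
by apply: commute_sym; apply: cRH' => //; apply: mem_commg.
Qed.

Let comm_in_depth x g : x \in N -> g \in H -> [~ x, g] \in 'Mho^(power_depth p)(N).
Proof. by move=> Nx Hg; apply: (subsetP embN); apply: mem_commg. Qed.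

Let comm_in x g : x \in N -> g \in H -> [~ x, g] \in 'Mho^1(N).
Proof. by move=> Nx Hg; apply: (subsetP (Mho_depth_sub p N)); apply: comm_in_depth. Qed.

Let power_comm n x g : x \in N -> g \in H ->
  [~ x ^+ n, g] = [~ x, g] ^+ n * [~ [~ x, g], x] ^+ 'C(n, 2).
Proof.
move=> Nx Hg; set c := [~ x, g].
have Mc: c \in 'Mho^1(N) by apply: comm_in.
have Hx := subsetP sNH x Nx.
have Hc := subsetP sNH c (subsetP sMN c Mc).
rewrite commgEl conjXg (_ : x ^ g = x * c) ?conjg_mulR //.
rewrite (expMg_Rmul n) ?[in RHS]mulgA ?mulKg; first by rewrite !mulgA mulVg mul1g.
- exact: central_comm.
- exact: central_comm.
Qed.

Lemma Mho1_central : 'Mho^1(N) \subset 'C(H).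
Proof.
rewrite (MhoE 1 pN) expn1 gen_subG; apply/subsetP=> _ /imsetP[x Nx ->].
apply/centP=> g Hg; apply/commgP; rewrite power_comm //.
have Mc: [~ x, g] \in 'Mho^1(N) by apply: comm_in.
have Hx := subsetP sNH x Nx.
have Hc := subsetP sNH _ (subsetP sMN _ Mc).
have [p2|p_odd] := eqVneq p 2; last first.
  have dE: power_depth p = 1%N by rewrite /power_depth (negbTE p_odd).
  have Mp u: u \in 'Mho^1(N) -> u ^+ p = 1.
    move=> Mu; apply/set1gP; rewrite -MhoMho1 dE -(expn1 p).
    exact: Mho_mem_power.
  case/dvdnP: (odd_prime_dvd_bin2 pr_p p_odd) => k ->.
  rewrite Mp // mul1g mulnC expgM -commXg ?Mp ?comm1g ?expg1n //.
  exact: central_comm.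
have dE: power_depth p = 2 by rewrite /power_depth p2.
have M4 u: u \in 'Mho^1(N) -> u ^+ 4 = 1.
  move=> Mu; apply/set1gP; rewrite -MhoMho1 dE.
  by have := Mho_mem_power 2 pM Mu; rewrite p2.
(* Here (p choose 2) = 1, so the factor [x, g, x] must vanish by itself.  For
   this D = Mho^2(N), in which the commutators of N with H lie, is shown to be
   centralised by H and then to have exponent 2. *)
have sDM: 'Mho^2(N) \subset 'Mho^1(N) by rewrite Mho_leq.
have sDH: 'Mho^2(N) \subset H by rewrite (subset_trans sDM) // (subset_trans sMN).
have sqD v : v \in N -> v ^+ 2 \in 'Mho^1(N).
  by move=> Nv; have := Mho_mem_power 1 pN Nv; rewrite p2 expn1.
(* On Mho^1(N) the map [-, h] is a morphism to the centre, and the generators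
   v ^ 4 of D are squares of elements v ^ 2 of exponent 4. *)
have D2 d h: d \in 'Mho^2(N) -> h \in H -> [~ d, h] ^+ 2 = 1.
  move=> Dd Hh.
  pose S := [set u in 'Mho^1(N) | [~ u, h] ^+ 2 == 1].
  have gS: group_set S.
    apply/group_setP; split; first by rewrite inE group1 comm1g expg1n eqxx.
    move=> u v /setIdP[Mu /eqP u2] /setIdP[Mv /eqP v2]; rewrite inE groupM //=.
    have Hv := subsetP sNH _ (subsetP sMN _ Mv).
    rewrite commMgJ (conjgE _ v) -(central_comm Mu Hh Hv) mulKg expgMn ?u2 ?v2 ?mulg1 //.
    apply: commute_sym; apply: central_comm => //.
    by rewrite groupR.
  suffices /subsetP/(_ d Dd): 'Mho^2(N) \subset Group gS.
    by rewrite inE => /andP[_ /eqP].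
  rewrite (MhoE 2 pN) gen_subG; apply/subsetP=> _ /imsetP[v Nv ->].
  have Mv := sqD v Nv; have Hv2 := subsetP sNH _ (subsetP sMN _ Mv).
  rewrite p2 (expgM v 2 2) inE groupX //= commXg; last exact: central_comm.
  rewrite -expgM -commXg; last exact: central_comm.
  by rewrite M4 // comm1g.
have cD d h: d \in 'Mho^2(N) -> h \in H -> commute d h.
  move=> Dd Hh; suffices /subsetP/(_ d Dd)/centP: 'Mho^2(N) \subset 'C(H) by apply.
  rewrite (MhoE 2 pN) gen_subG; apply/subsetP=> _ /imsetP[v Nv ->].
  apply/centP=> k Hk; apply/commgP; rewrite p2 (expgM v 2 2).
  have Mv := sqD v Nv; have Hv2 := subsetP sNH _ (subsetP sMN _ Mv).
  have Mvk : [~ v, k] \in 'Mho^1(N) by apply: comm_in.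
  have Dvk : [~ v, k] \in 'Mho^2(N) by rewrite -dE comm_in_depth.
  have Hv := subsetP sNH _ Nv.
  have Hvk := subsetP sNH _ (subsetP sMN _ Mvk).
  rewrite commXg; last exact: central_comm.
  rewrite power_comm // expg1 expgMn; last first.
    by apply: central_comm => //; rewrite groupX.
  by rewrite (D2 _ _ Dvk Hv) mulg1 -expgM M4.
have D_exp2 d: d \in 'Mho^2(N) -> d ^+ 2 = 1.
  have abD: abelian 'Mho^2(N).
    by apply/centsP=> u Du v Dv; apply: cD => //; apply: (subsetP sDH).
  pose S := [set u in 'Mho^2(N) | u ^+ 2 == 1].
  have gS: group_set S.
    apply/group_setP; split; first by rewrite inE group1 expg1n eqxx.
    move=> u v /setIdP[Du /eqP u2] /setIdP[Dv /eqP v2]; rewrite inE groupM //=.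
    by rewrite expgMn ?u2 ?v2 ?mulg1 //; apply: (centsP abD).
  move=> Dd; suffices /subsetP/(_ d Dd): 'Mho^2(N) \subset Group gS.
    by rewrite inE => /andP[_ /eqP].
  rewrite {1}(MhoE 2 pN) gen_subG; apply/subsetP=> _ /imsetP[v Nv ->].
  by rewrite inE Mho_mem_power //= p2 (expgM v 2 2) -(expgM (v ^+ 2) 2 2) M4 ?sqD.
have Dc: [~ x, g] \in 'Mho^2(N) by rewrite -dE comm_in_depth.
rewrite p2 D_exp2 // mul1g binn expg1.
by apply/commgP; apply: cD.
Qed.

End CentralPowers.

Definition powerfully_embedded (gT : finGroupType) (p : nat) (N H : {set gT}) :=
  (N <| H) && ([~: N, H] \subset 'Mho^(power_depth p)(N)).

(** Modulo B, A equals [A, H], and a nilpotent group has no nontrivial subgroup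
    with this property.  So the inclusion of A in B may be checked modulo
    [A, H]. *)
Lemma nilpotent_commutator_sub (gT : finGroupType) (H A B : {group gT}) :
  nilpotent H -> A <| H -> B <| H -> A \subset B <*> [~: A, H] -> A \subset B.
Proof.
move=> nilH /andP[sAH nAH] /andP[_ nBH] sABR.
have nBA := subset_trans sAH nBH.
have nBR: [~: A, H] \subset 'N(B).
  by apply: subset_trans nBA; rewrite commg_subl.
rewrite -quotient_sub1 //; apply/trivgP/eqP.
have /forallP/(_ (A / B)%G) := quotient_nil B nilH; move/implyP; apply.
rewrite subsetI quotientS //= -quotientR //.
by have := quotientS B sABR; rewrite quotientYidl.
Qed.

Lemma powerfully_embedded_Mho1 (gT : finGroupType) (p : nat) (N H : {group gT}) :
  prime p -> p.-group H -> powerfully_embedded p N H ->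
  powerfully_embedded p 'Mho^1(N) H.
Proof.
move=> pr_p pH /andP[nNH embN].
have nMH: 'Mho^1(N) <| H by apply: gFnormal_trans.
have nBH: 'Mho^(power_depth p)('Mho^1(N)) <| H by do 2!apply: gFnormal_trans.
rewrite /powerfully_embedded nMH /=.
pose A := [~: 'Mho^1(N), H]%G; pose B := 'Mho^(power_depth p)('Mho^1(N))%G.
have nAH: A <| H.
  rewrite /normal normsRr // andbT (subset_trans _ (normal_sub nMH)) //.
  by rewrite commg_subl normal_norm.
have nRH: [~: A, H] <| H.
  rewrite /normal normsRr // andbT (subset_trans _ (normal_sub nAH)) //.
  by rewrite commg_subl normal_norm.
apply: (@nilpotent_commutator_sub _ H A B) => //; first exact: pgroup_nil pH.
pose T := (B <*> [~: A, H])%G; have nTH: T <| H by apply: normalY.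
have nTH' := normal_norm nTH.
have nTN: N \subset 'N(T) := subset_trans (normal_sub nNH) nTH'.
have nTM: 'Mho^1(N) \subset 'N(T) := subset_trans (normal_sub nMH) nTH'.
suff: A \subset T by []; rewrite /A /= -quotient_cents2 //.
have MhoT n (K : {group gT}) : K \subset 'N(T) -> 'Mho^n(K) / T = 'Mho^n(K / T).
  exact: morphim_Mho.
rewrite MhoT //; apply: (Mho1_central (p := p)) => //.
- exact: quotient_pgroup.
- exact: quotient_normal.
- by rewrite -quotientR // -MhoT // quotientS.
- by rewrite /= -!MhoT //; apply: quotientS1; apply: joing_subl.
rewrite /= -MhoT // -!quotientR // ?(subset_trans (normal_sub nAH)) //.
by apply: quotientS1; apply: joing_subr.
Qed.

(** Taking p-th powers is a morphism from N onto Mho^1(N) / Mho^1(Mho^1(N)),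
    since modulo the last subgroup N has class at most 2 and the correction
    term [y, x] ^ (p choose 2) vanishes; K is its kernel. *)
Lemma power_map (gT : finGroupType) (p : nat) (N H : {group gT}) :
  prime p -> p.-group H -> powerfully_embedded p N H ->
  exists K : {group gT},
    [/\ 'Mho^1(N) \subset K, K \subset N,
        {in N, forall x, (x \in K) = (x ^+ p \in 'Mho^1('Mho^1(N)))},
        #|N : K| = #|'Mho^1(N) : 'Mho^1('Mho^1(N))|
      & {in 'Mho^1(N), forall g,
          exists2 x, x \in N & x ^- p * g \in 'Mho^1('Mho^1(N))}].
Proof.
move=> pr_p pH embN; have /andP[_ embM] := powerfully_embedded_Mho1 pr_p pH embN.
have [nNH embN'] := andP embN.
have sNH := normal_sub nNH; have pN := pgroupS sNH pH.
have nN2: N \subset 'N('Mho^1('Mho^1(N))).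
  by apply: normal_norm; do 2!apply: gFnormal_trans.
set N1 := 'Mho^1(N)%G in nN2 *; set N2 := 'Mho^1(N1)%G.
have sN1N: N1 \subset N by apply: Mho_sub.
have sN2N1: N2 \subset N1 by apply: Mho_sub.
have nN21: N1 \subset 'N(N2) := subset_trans sN1N nN2.
have cN1: N1 / N2 \subset 'C(N / N2).
  rewrite quotient_cents2 //; apply: subset_trans (commgS _ sNH) _.
  exact: subset_trans embM (Mho_depth_sub _ _).
have pow_in x : x \in N -> x ^+ p \in N1.
  by move=> Nx; have := Mho_mem_power 1 pN Nx; rewrite expn1.
pose phi x := coset N2 (x ^+ p).
have phiM: {in N &, {morph phi : x y / x * y}}.
  move=> x y Nx Ny; rewrite /phi !morphX ?groupM ?(subsetP nN2) //.
  rewrite morphM ?(subsetP nN2) //.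
  have cyx: [~ coset N2 y, coset N2 x] = coset N2 [~ y, x].
    by rewrite morphR ?(subsetP nN2).
  have D_yx: [~ y, x] \in 'Mho^(power_depth p)(N).
    by apply: (subsetP embN'); rewrite mem_commg ?(subsetP sNH).
  have M_yx: [~ y, x] \in N1 by apply: (subsetP (Mho_depth_sub p N)).
  have cc z: z \in N -> commute (coset N2 z) (coset N2 [~ y, x]).
    move=> Nz; apply: commute_sym; apply: (centsP cN1); exact: mem_quotient.
  rewrite (expMg_Rmul p) cyx; [|exact: cc|exact: cc].
  suffices ->: coset N2 [~ y, x] ^+ 'C(p, 2) = 1 by rewrite mulg1.
  have [p2|p_odd] := eqVneq p 2.
    rewrite coset_id ?expg1n //; apply: (subsetP (Mho2_sub_Mho11 pN)).
    by move: D_yx; rewrite /power_depth p2.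
  case/dvdnP: (odd_prime_dvd_bin2 pr_p p_odd) => k ->.
  rewrite mulnC expgM -morphX ?(subsetP nN21) //= coset_id ?expg1n //.
  by have := Mho_mem_power 1 (pgroupS sN1N pN) M_yx; rewrite expn1.
pose f := Morphism phiM.
have kE x : x \in N -> (x \in 'ker f) = (x ^+ p \in N2).
  move=> Nx; apply/kerP/idP => //= [|h]; last exact: coset_id.
  by rewrite /= /phi => /coset_idr; apply; rewrite (subsetP nN21) ?pow_in.
have imf: f @* N = N1 / N2.
  rewrite morphimEdom; apply/eqP; rewrite eqEsubset; apply/andP; split.
    by apply/subsetP=> _ /imsetP[x Nx ->]; apply: mem_quotient; apply: pow_in.
  rewrite -morphimEdom [N1 / N2]/quotient sub_morphim_pre //.
  set S := _ @*^-1 _; have sgS: generated [set x ^+ p | x in N] \subset S.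
    rewrite gen_subG; apply/subsetP=> _ /imsetP[x Nx ->].
    rewrite mem_morphpre ?(subsetP nN21) ?pow_in //= morphimEdom.
    by apply/imsetP; exists x.
  by apply: subset_trans sgS; rewrite /N1 /= (MhoE 1 pN) expn1.
exists ('ker f)%G; split.
- apply/subsetP=> x N1x; rewrite kE ?(subsetP sN1N) //.
  by have := Mho_mem_power 1 (pgroupS sN1N pN) N1x; rewrite expn1.
- exact: subsetIl.
- exact: kE.
- by rewrite /= -(card_quotient nN21) -imf card_morphim setIid.
move=> g N1g; have: coset N2 g \in f @* N by rewrite imf mem_quotient.
rewrite morphimEdom => /imsetP[x Nx /= gx]; exists x => //.
have N1xp := pow_in x Nx.
apply: coset_idr; first by rewrite (subsetP nN21) ?groupM ?groupV.
by rewrite morphM ?morphV ?(subsetP nN21) ?groupV //= gx /phi mulVg.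
Qed.

(** By induction along the series N, Mho^1(N), Mho^1(Mho^1(N)), ...: modulo
    Mho^1(N), E lies in the kernel of the power map, which has order
    |N : Mho^1(N)| divided by the bound for Mho^1(N).  In the case of equality
    E covers that kernel. *)
Lemma exponent_subgroup_bound (gT : finGroupType) (p : nat) (H N E : {group gT}) :
  prime p -> p.-group H -> powerfully_embedded p N H ->
  E \subset N -> {in E, forall x, x ^+ p = 1} ->
  #|E| <= #|N : 'Mho^1(N)|
  /\ (#|E| = #|N : 'Mho^1(N)| ->
      {in N, forall x, x ^+ p \in 'Mho^1('Mho^1(N)) -> x \in E * 'Mho^1(N)}).
Proof.
move=> pr_p pH; have [n] := ubnP #|N|; elim: n N E => // n IHn N E leNn embN sEN expE.
have [nNH _] := andP embN; have sNH := normal_sub nNH.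
have pN := pgroupS sNH pH.
have [K [sMK sKN Kp iNK _]] := power_map pr_p pH embN.
have embM := powerfully_embedded_Mho1 pr_p pH embN.
have nME: E \subset 'N('Mho^1(N)).
  by apply: subset_trans sEN _; apply: gFnorm.
have sEK: E \subset K.
  apply/subsetP=> x Ex; rewrite Kp ?(subsetP sEN) //.
  by rewrite expE.
have [N1 | ntN] := eqsVneq N 1.
  have E1: E :=: 1 by apply/trivgP; rewrite -N1.
  split=> [|_ x Nx _]; first by rewrite E1 cards1.
  by move: Nx; rewrite {1}N1 => /set1gP->; rewrite -(mulg1 1) mem_mulg ?group1.
have ltMN: #|'Mho^1(N)| < n.
  rewrite -ltnS (leq_trans _ leNn) // ltnS proper_card //.
  apply: sub_proper_trans (Phi_proper ntN).
  by rewrite (Phi_joing pN) joing_subr.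
have expEM: {in E :&: 'Mho^1(N), forall x, x ^+ p = 1}.
  by move=> x /setIP[/expE].
have [leI _] := IHn 'Mho^1(N)%G (E :&: 'Mho^1(N))%G ltMN embM (subsetIr _ _) expEM.
have cE := mul_cardG E 'Mho^1(N)%G.
have sEM: E * 'Mho^1(N) \subset K by rewrite mul_subG.
have cN: (#|K| * #|N : K| = #|N|)%N := Lagrange sKN.
have cM: (#|'Mho^1(N)| * #|N : 'Mho^1(N)| = #|N|)%N := Lagrange (Mho_sub 1 N).
have leEM := subset_leq_card sEM.
rewrite -iNK /= in leI; split=> [|eqE x Nx].
  rewrite -(leq_pmul2r (cardG_gt0 'Mho^1(N))) cE [X in _ <= X]mulnC cM -cN.
  exact: leq_mul.
rewrite -Kp // => Kx; suffices /eqP->: E * 'Mho^1(N) == K by [].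
rewrite eqEcard sEM -(leq_pmul2r (indexg_gt0 N K)) cN -cM mulnC -eqE cE.
by rewrite leq_mul2l leI orbT.
Qed.

Lemma powerful_embedded (gT : finGroupType) (p : nat) (H : {group gT}) :
  powerful p H = (p.-group H) && powerfully_embedded p H H.
Proof.
rewrite /powerful /powerfully_embedded normal_refl /=.
by case: (boolP (p.-group H)) => //= pH; rewrite power_subgroup_Mho.
Qed.

Lemma powerful_Phi (gT : finGroupType) (p : nat) (H : {group gT}) :
  powerful p H -> 'Phi(H) = 'Mho^1(H).
Proof.
rewrite powerful_embedded => /and3P[pH _ sH'M].
rewrite (Phi_joing pH); apply/joing_idPr.
exact: subset_trans sH'M (Mho_depth_sub p H).
Qed.

(** By power_map an element of Mho^1(H) is x ^ p * t with t in
    Mho^1(Mho^1(H)), hence lies in Mho^1(<x> Mho^1(H)); this subgroup is again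
    powerful, and it is proper unless H is cyclic. *)
Lemma powerful_Mho1_root (gT : finGroupType) (p : nat) (H : {group gT}) :
  prime p -> powerful p H ->
  {in 'Mho^1(H), forall g, exists2 x, x \in H & g = x ^+ p}.
Proof.
move=> pr_p; have [n] := ubnP #|H|; elim: n H => // n IHn H leHn powH.
have [pH embH] := andP (etrans (esym (powerful_embedded p H)) powH).
have [K [_ _ _ _ rootH]] := power_map pr_p pH embH.
have embM := powerfully_embedded_Mho1 pr_p pH embH.
move=> g Mg; have [x Hx t2] := rootH g Mg.
have sMH := Mho_sub 1 H.
have nMx: <[x]> \subset 'N('Mho^1(H)).
  by rewrite cycle_subG (subsetP (gFnorm _ _)).
pose L := (<[x]> <*> 'Mho^1(H))%G.
have sLH: L \subset H by rewrite join_subG cycle_subG Hx sMH.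
have sML: 'Mho^1(H) \subset L by apply: joing_subr.
have Lx: x \in L by rewrite (subsetP (joing_subl _ _)) ?cycle_id.
have pL := pgroupS sLH pH.
have Mg': g \in 'Mho^1(L).
  rewrite -(mulKVg (x ^+ p) g) groupM //.
    by have := Mho_mem_power 1 pL Lx; rewrite expn1.
  by apply: subsetP t2; apply: MhoS.
have [eqLH | neqLH] := eqVneq L H.
  have: <<[set x]>> = H.
    by apply: Phi_nongen; rewrite (powerful_Phi powH) joingC -joing_idl; apply: congr_group eqLH.
  rewrite -/(cycle x) => defH; move: Mg; rewrite -defH (Mho_p_cycle 1 (mem_p_elt pH Hx)).
  rewrite expn1 => /cycleP[k ->]; exists (x ^+ k); first by rewrite mem_cycle.
  by rewrite -!expgM mulnC.
have ltLn: #|L| < n.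
  by rewrite -ltnS (leq_trans _ leHn) // ltnS proper_card // properEneq neqLH.
have powL: powerful p L.
  rewrite /powerful pL (power_subgroup_Mho pL) /=.
  have sRM: [~: 'Mho^1(H), H] \subset 'Mho^1(H) by rewrite commg_subl gFnorm.
  have nRH: H \subset 'N([~: 'Mho^1(H), H]) by apply: normsRr.
  pose R := [~: 'Mho^1(H), H]%G.
  have /andP[_ sRD] := embM.
  apply: subset_trans (subset_trans sRD (MhoS _ sML)).
  rewrite der1_min ?(subset_trans sLH) //.
  have abM: 'Mho^1(H) / R \subset 'C(L / R).
    by rewrite quotient_cents2r // commgS.
  apply: (@cyclic_factor_abelian _ ('Mho^1(H) / R)%G).
    by rewrite subsetI abM quotientS.
  rewrite /= /L /= quotientY ?(subset_trans _ nRH) //; last by rewrite cycle_subG.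
  rewrite quotientYidr; last by rewrite quotient_norms.
  by rewrite !quotient_cyclic ?cycle_cyclic.
have [y Ly ->] := IHn L ltLn powL g Mg'.
by exists y => //; apply: (subsetP sLH).
Qed.

Lemma powerful_exponent_bound (gT : finGroupType) (p : nat) (H E : {group gT}) :
  prime p -> powerful p H -> E \subset H -> {in E, forall x, x ^+ p = 1} ->
  #|E| <= #|H : 'Phi(H)|.
Proof.
move=> pr_p powH sEH expE; rewrite (powerful_Phi powH).
have [pH embH] := andP (etrans (esym (powerful_embedded p H)) powH).
by case: (exponent_subgroup_bound pr_p pH embH sEH expE).
Qed.

Lemma powerful_exponent_extremal (gT : finGroupType) (p : nat) (H E : {group gT}) :
  prime p -> powerful p H -> E \subset H -> {in E, forall x, x ^+ p = 1} ->
  #|E| = #|H : 'Phi(H)| ->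
  {in H, forall x, x ^+ p \in 'Mho^1('Mho^1(H)) -> x \in E * 'Phi(H)}.
Proof.
move=> pr_p powH sEH expE; rewrite (powerful_Phi powH).
have [pH embH] := andP (etrans (esym (powerful_embedded p H)) powH).
by case: (exponent_subgroup_bound pr_p pH embH sEH expE) => _; apply.
Qed.

(** * Automorphisms of extensions by a cyclic group *)

Section CyclicExtension.
Variables (gT : finGroupType) (G K : {group gT}) (g : gT).
Hypotheses (nKG : K <| G) (Gg : g \in G) (genGK : G / K = <[coset K g]>).

Let Ng : g \in 'N(K). Proof. exact: (subsetP (normal_norm nKG)). Qed.
Let sKG : K \subset G. Proof. exact: normal_sub. Qed.

Lemma cyclic_ext_decomp x : x \in G -> exists i, exists2 k, k \in K & x = g ^+ i * k.
Proof.
move=> Gx; have Nx: x \in 'N(K) by rewrite (subsetP (normal_norm nKG)).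
have: coset K x \in <[coset K g]> by rewrite -genGK mem_quotient.
case/cycleP=> i Exi; exists i, (g ^- i * x); last by rewrite mulKVg.
apply: coset_idr; first by rewrite groupM ?groupV ?groupX.
by rewrite morphM ?morphV ?morphX ?groupV ?groupX //= Exi mulVg.
Qed.

Lemma cyclic_ext_index : #|G : K| = #[coset K g].
Proof. by rewrite orderE -genGK card_quotient // normal_norm. Qed.

Lemma cyclic_ext_Aut_eq a b : a \in Aut G -> b \in Aut G ->
  {in K, a =1 b} -> a g = b g -> a = b.
Proof.
move=> Aa Ab eqK eqg; apply: (eq_Aut Aa Ab) => x Gx.
have [i [k Kk ->]] := cyclic_ext_decomp Gx.
have Gk := subsetP sKG k Kk.
rewrite -(autmE Aa) -(autmE Ab) !morphM ?morphX ?groupX //= !autmE.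
by rewrite eqg eqK.
Qed.

Variable y : gT.
Hypotheses (Zy : y \in 'Z(K)) (gyn : (g * y) ^+ #|G : K| = g ^+ #|G : K|).

Let Ky : y \in K. Proof. by case/setIP: Zy. Qed.
Let cKy k : k \in K -> commute y k. Proof. by case/setIP: Zy => _ /centP/(_ k). Qed.
Let n := #|G : K|.

(* An element x of g ^ i * K is to be sent to (g * y) ^ i * g ^- i * x; the
   factor of x depends only on i modulo n. *)
Let ratio i := (g * y) ^+ i * g ^- i.

Let ratio_mod i j : i = j %[mod n] -> ratio i = ratio j.
Proof.
suffices ratio_small m : ratio m = ratio (m %% n).
  by rewrite (ratio_small i) => ->.
rewrite /ratio {1 2}(divn_eq m n) addnC mulnC !expgD !(expgM _ n) gyn -/n.
by rewrite invMg mulgA mulgK.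
Qed.

Let log x := find (fun i => g ^- i * x \in K) (iota 0 n).
Let f x := ratio (log x) * x.

Let fE i k : k \in K -> f (g ^+ i * k) = (g * y) ^+ i * k.
Proof.
move=> Kk; set x := g ^+ i * k; rewrite /f.
have logP: g ^- log x * x \in K.
  have h: has (fun i => g ^- i * x \in K) (iota 0 n).
    apply/hasP; exists (i %% n).
      by rewrite mem_iota ltn_mod indexg_gt0.
    rewrite /x mulgA groupMr //; apply: coset_idr.
      by rewrite groupM ?groupV ?groupX.
    rewrite morphM ?morphV ?morphX ?groupV ?groupX //=.
    by rewrite /n cyclic_ext_index expg_mod_order mulVg.
  have := nth_find 0 h; rewrite -/(log x) nth_iota //.
  by move: h; rewrite has_find size_iota.
rewrite (@ratio_mod _ i) /ratio ?mulgA ?mulgKV //.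
apply/eqP; rewrite /n cyclic_ext_index -eq_expg_mod_order.
move: logP; rewrite /x mulgA groupMr // => /coset_id.
rewrite morphM ?morphV ?morphX ?groupV ?groupX //= => /eqP.
by rewrite -eq_mulVg1.
Qed.

Let fM : {in G &, {morph f : a b / a * b}}.
Proof.
have conj_gy j k : k \in K -> k ^ ((g * y) ^+ j) = k ^ (g ^+ j).
  elim: j k => [|j IHj] k Kk; first by rewrite !expg0.
  have Kkg: k ^ g \in K by rewrite memJ_norm.
  rewrite !expgS !conjgM (_ : (k ^ g) ^ y = k ^ g) ?IHj //.
  by rewrite /conjg -(cKy Kkg) mulKg.
move=> a b Ga Gb; have [i [k Kk ->]] := cyclic_ext_decomp Ga.
have [j [l Kl ->]] := cyclic_ext_decomp Gb.
have NXg m: g ^+ m \in 'N(K) by rewrite groupX.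
have Kkj: k ^ (g ^+ j) \in K by rewrite memJ_norm.
have ->: g ^+ i * k * (g ^+ j * l) = g ^+ (i + j) * (k ^ (g ^+ j) * l).
  by rewrite expgD /conjg !mulgA mulgK.
rewrite (fE _ (groupM Kkj Kl)) !fE // -conj_gy // expgD.
by rewrite /conjg !mulgA mulgK.
Qed.

(** As y centralises K, g and g * y act on K in the same way, and they have the
    same n-th power: one generator can replace the other. *)
Lemma cyclic_ext_Aut :
  exists2 a, a \in Aut G & {in K, a =1 id} /\ a g = g * y.
Proof.
pose F := Morphism fM.
have Gy := subsetP sKG y Ky.
have FK k: k \in K -> F k = k.
  by move=> Kk; have := fE 0 Kk; rewrite !expg0 !mul1g.
have Fg: F g = g * y.
  by have := fE 1 (group1 K); rewrite !expg1 !mulg1.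
have injF: 'injm F.
  apply/subsetP=> x /morphpreP[Gx /set1P/= Fx1].
  have [i [k Kk Dx]] := cyclic_ext_decomp Gx.
  move: Fx1; rewrite Dx fE // => Fx1.
  have Kx: x \in K.
    have Nk: k \in 'N(K) by apply: (subsetP (normG K)).
    have Nyy: y \in 'N(K) by apply: (subsetP (normG K)).
    apply: coset_idr; first by rewrite Dx groupM ?groupX.
    rewrite Dx -[RHS](morph1 (coset K)) -Fx1.
    by rewrite !morphM ?morphX ?groupX ?groupM // morphM //= (coset_id Ky) mulg1.
  by rewrite -Dx -(FK x Kx) /= Dx fE // Fx1 set11.
have imF: F @* G = G.
  apply/eqP; rewrite eqEcard card_injm // leqnn andbT.
  apply/subsetP=> _ /morphimP[x _ Gx ->] /=.
  have [i [k Kk ->]] := cyclic_ext_decomp Gx.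
  by rewrite fE // !groupM ?groupX ?groupM // (subsetP sKG).
exists (aut injF imF); first exact: Aut_aut.
split=> [k Kk|]; first by rewrite autE ?(subsetP sKG) //; apply: FK.
by rewrite autE.
Qed.

Lemma cyclic_ext_Aut_prime p : prime p -> y != 1 -> y ^+ p = 1 ->
  exists2 a, a \in Aut G & [/\ #[a] = p, {in K, a =1 id} & a g = g * y].
Proof.
move=> pr_p nty yp; have [a Aa [aK ag]] := cyclic_ext_Aut.
have aX i: {in K, (a ^+ i) =1 id} /\ (a ^+ i) g = g * y ^+ i.
  elim: i => [|i [IHK IHg]].
    by split=> [k _|]; rewrite expg0 perm1 ?mulg1.
  split=> [k Kk|]; first by rewrite expgSr permM IHK // aK.
  rewrite expgSr permM IHg (morphicP (Aut_morphic Aa)) //; last first.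
    by rewrite groupX ?(subsetP sKG).
  by rewrite ag aK ?groupX // -mulgA -expgS.
exists a => //; split=> //; apply: nt_prime_order => //.
  have [aK1 ag1] := aX p.
  apply: cyclic_ext_Aut_eq => [||k Kk|]; rewrite ?groupX ?group1 ?perm1 //; first exact: aK1.
  by rewrite ag1 yp mulg1.
apply: contraNneq nty => a1; move: ag; rewrite a1 perm1 => /eqP.
by rewrite -{1}(mulg1 g) (inj_eq (mulgI g)) eq_sym.
Qed.

End CyclicExtension.

(** * Inner automorphisms and indices *)

Lemma InnP (gT : finGroupType) (G : {group gT}) (a : {perm gT}) :
  a \in Aut G ->
  reflect (exists2 h, h \in G & {in G, forall x, a x = x ^ h}) (a \in Inn G).
Proof.
move=> Aa; apply: (iffP idP) => [/morphimP[h Nh Gh ->] | [h Gh ah]].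
  by exists h => // x Gx; rewrite norm_conj_autE.
have Nh: h \in 'N(G) by apply: (subsetP (normG G)).
apply/morphimP; exists h => //; apply: (eq_Aut Aa) => [|x Gx].
  exact: Aut_aut.
by rewrite ah // norm_conj_autE.
Qed.

Lemma prime_quotient_cycle (gT : finGroupType) (p : nat) (G M : {group gT}) g :
  prime p -> M <| G -> #|G : M| = p -> g \in G -> g \notin M ->
  G / M = <[coset M g]>.
Proof.
move=> pr_p nMG iM Gg nMg; have Ng := subsetP (normal_norm nMG) g Gg.
have oQ: #|G / M| = p by rewrite card_quotient // normal_norm.
apply/eqP; rewrite eq_sym eqEcard cycle_subG mem_quotient //= oQ -orderE.
have: #[coset M g] %| p by rewrite -oQ order_dvdG ?mem_quotient.
case/primeP: pr_p => _ h /h /orP[|/eqP->//]; rewrite order_eq1 => /eqP/coset_idr.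
by move/(_ Ng) => Mg; rewrite Mg in nMg.
Qed.

Lemma leq_indexI (gT : finGroupType) (G A B : {group gT}) :
  A \subset G -> B \subset G -> #|G : A :&: B| <= #|G : A| * #|G : B|.
Proof.
move=> sAG sBG; rewrite -(Lagrange_index sAG (subsetIl A B)) leq_mul2l; apply/orP; right.
rewrite -(leq_pmul2l (cardG_gt0 (A :&: B))) Lagrange ?subsetIl //.
rewrite -(leq_pmul2r (cardG_gt0 B)) mul_cardG [X in X <= _]mulnC -mulnA leq_mul2l.
by rewrite [X in _ <= X]mulnC Lagrange // subset_leq_card ?mul_subG ?orbT.
Qed.

(** * The centre modulo a central subgroup of order p *)

Section RelativeCenter.
Variables (gT : finGroupType) (p : nat) (G : {group gT}) (z : gT).
Hypotheses (pr_p : prime p) (pG : p.-group G) (Zz : z \in 'Z(G)) (oz : #[z] = p).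

Definition center_mod : {set gT} := coset <[z]> @*^-1 'Z(G / <[z]>).
Canonical center_mod_group := Eval hnf in [group of center_mod].
Local Notation W := center_mod.

Let sZZ : <[z]> \subset 'Z(G). Proof. by rewrite cycle_subG. Qed.
Let nZG : <[z]> <| G. Proof. exact: sub_center_normal. Qed.

Lemma center_modP w :
  reflect (w \in G /\ {in G, forall x, [~ x, w] \in <[z]>}) (w \in W).
Proof.
have nG := normal_norm nZG.
apply: (iffP idP) => [Ww | [Gw cw]].
  have [Nw Zw] := morphpreP Ww.
  have Gw: w \in G.
    rewrite -[gval G](quotientGK nZG); apply/morphpreP; split=> //.
    exact: subsetP (center_sub _) _ Zw.
  split=> // x Gx; apply: coset_idr; first by rewrite groupR ?(subsetP nG).
  rewrite morphR ?(subsetP nG) //; apply/eqP/commgP.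
  case/setIP: Zw => _ /centP cZ; apply: commute_sym; apply: cZ.
  exact: mem_quotient.
rewrite mem_morphpre ?(subsetP nG) //; apply/setIP; rewrite mem_quotient //; split=> //.
apply/centP=> _ /morphimP[x Nx Gx ->]; apply: commute_sym; apply/commgP/eqP.
by rewrite -morphR ?(subsetP nG) //= coset_id ?cw.
Qed.

Lemma center_mod_sub : W \subset G.
Proof. by apply/subsetP=> w /center_modP[]. Qed.

Lemma center_sub_mod : 'Z(G) \subset W.
Proof.
apply/subsetP=> w Zw; apply/center_modP; case/setIP: (Zw) => Gw /centP cw.
by split=> // x Gx; rewrite (_ : [~ x, w] = 1) ?group1 //; apply/eqP/commgP/commute_sym/cw.
Qed.

Lemma comm_center_mod w x : w \in W -> x \in G -> [~ x, w] \in 'Z(G).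
Proof. by case/center_modP=> Gw cw Gx; apply: (subsetP sZZ); apply: cw. Qed.

Lemma center_mod_exp w : w \in W -> w ^+ p \in 'Z(G).
Proof.
move=> Ww; have [Gw cw] := center_modP _ Ww.
apply/setIP; split; first exact: groupX.
apply/centP=> x Gx; apply: commute_sym; apply/commgP/eqP.
rewrite commgX; last first.
  by case/setIP: (comm_center_mod Ww Gx) => _ /centP h; apply: commute_sym; apply: h.
by case/cycleP: (cw x Gx) => i ->; rewrite -expgM mulnC expgM -oz expg_order expg1n.
Qed.

Lemma index_cent1_center_mod w : w \in W -> #|G : 'C_G[w]| <= p.
Proof.
move=> Ww; have [Gw cw] := center_modP _ Ww.
rewrite index_cent1 -oz orderE -(card_lcoset <[z]> w) subset_leq_card //.
apply/subsetP=> _ /imsetP[x Gx ->]; rewrite mem_lcoset -commgEl.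
by rewrite -invg_comm groupV cw.
Qed.

(** Each step up a chain of subgroups of index p from 'Z(G) to X adds one
    generator x, and x has at most p conjugates. *)
Lemma index_cent_center_mod (X : {group gT}) : 'Z(G) \subset X -> X \subset W ->
  #|G : 'C_G(X)| <= #|X : 'Z(G)|.
Proof.
have [n] := ubnP #|X|; elim: n X => // n IHn X leXn sZX sXW.
have pX: p.-group X by apply: pgroupS pG; apply: subset_trans center_mod_sub.
have [ZX | [M maxM sZM]] := maximal_exists sZX.
  rewrite -ZX (setIidPl _) ?indexgg //.
  by rewrite centsC subsetIr.
have [sMX nMX] := andP (p_maximal_normal pX maxM).
have iM := p_maximal_index pX maxM.
have ltMX := maxgroupp maxM; have [_ [x Xx nMx]] := properP ltMX.
have Wx := subsetP sXW x Xx.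
have leMn: #|M| < n by apply: leq_trans (proper_card ltMX) _; rewrite -ltnS.
have := IHn M leMn sZM (subset_trans sMX sXW).
rewrite -(Lagrange_index sMX sZM) iM => leM.
have genX: M <*> <[x]> = X.
  apply/eqP; rewrite eqEsubset join_subG sMX cycle_subG Xx /=.
  rewrite -(quotientSGK _ (joing_subl _ _)) //.
  rewrite (prime_quotient_cycle pr_p (p_maximal_normal pX maxM) iM Xx nMx).
  rewrite cycle_subG mem_quotient //.
  by rewrite (subsetP (joing_subr _ _)) ?cycle_id.
have cX: 'C_G(M) :&: 'C_G[x] \subset 'C_G(X).
  by rewrite -genX centY cent_cycle setIACA setIid.
apply: leq_trans (leq_trans (leq_indexI (subsetIl _ _) (subsetIl _ _)) _).
  by apply: dvdn_leq; [rewrite indexg_gt0 | apply: indexgS; exact: cX].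
by rewrite mulnC leq_mul // index_cent1_center_mod.
Qed.
End RelativeCenter.

(** * Groups whose automorphisms of order p fixing Phi(G) are inner *)

Section FrattiniInner.
Variables (gT : finGroupType) (p : nat) (G : {group gT}).
Hypotheses (pr_p : prime p) (pG : p.-group G) (nabG : ~~ abelian G).
Hypothesis innG : forall a : {perm gT},
  a \in Aut G -> #[a] = p -> {in 'Phi(G), a =1 id} -> a \in Inn G.

Lemma central_shift (M : {group gT}) g y : maximal M G -> g \in G -> g \notin M ->
  y \in 'Z(G) -> y \in M -> #[y] = p ->
  exists2 h, h \in G & {in M, forall x, x ^ h = x} /\ g ^ h = g * y.
Proof.
move=> maxM Gg nMg Zy My oy.
have nMG := p_maximal_normal pG maxM; have iM := p_maximal_index pG maxM.
have genM := prime_quotient_cycle pr_p nMG iM Gg nMg.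
have [Gy /centP cy] := setIP Zy.
have yp : y ^+ p = 1 by rewrite -oy expg_order.
have ZMy: y \in 'Z(M).
  by rewrite inE My; apply/centP=> k Mk; apply: cy; rewrite (subsetP (normal_sub nMG)).
have gyp: (g * y) ^+ #|G : M| = g ^+ #|G : M|.
  by rewrite iM expgMn ?yp ?mulg1 //; apply: commute_sym; apply: cy.
have nty: y != 1 by rewrite -order_eq1 oy; case: (p) pr_p => [|[]].
have [a Aa [oa aM ag]] := cyclic_ext_Aut_prime nMG Gg genM ZMy gyp pr_p nty yp.
have Ia: a \in Inn G.
  by apply: innG => // x Px; apply: aM; apply: subsetP Px; apply: Phi_sub_max.
have [h Gh ah] := InnP Aa Ia; exists h => //; split=> [x Mx|]; last by rewrite -ah.
by rewrite -ah ?aM // (subsetP (normal_sub nMG)).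
Qed.

(** Otherwise G = M * <[z]>, so that 'Z(M) is central in G, and the automorphism
    that fixes M and multiplies z by an element of order p of 'Z(M) moves the
    central element z. *)
Lemma central_in_maximal (M : {group gT}) z :
  maximal M G -> z \in 'Z(G) -> #[z] = p -> z \in M.
Proof.
move=> maxM Zz oz; apply/idPn=> nMz.
have nMG := p_maximal_normal pG maxM; have iM := p_maximal_index pG maxM.
have sMG := normal_sub nMG.
have [Gz /centP cz] := setIP Zz.
have genM := prime_quotient_cycle pr_p nMG iM Gz nMz.
have pM := pgroupS sMG pG.
have [M1 | ntM] := eqsVneq M 1.
  case/negP: nabG; apply: cyclic_abelian; apply: prime_cyclic.
  by rewrite -(indexg1 G) -M1 iM.
have ntZM: 'Z(M) != 1 by rewrite center_nil_eq1 ?(pgroup_nil pM).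
have pZM: p.-group 'Z(M) := pgroupS (center_sub M) pM.
have [_ pdvZ _] := pgroup_pdiv pZM ntZM.
have [y ZMy oy] := Cauchy pr_p pdvZ.
have [My /centP cy] := setIP ZMy.
have ZGy: y \in 'Z(G).
  apply/setIP; split; first exact: (subsetP sMG).
  apply/centP=> x Gx; have [i [k Mk ->]] := cyclic_ext_decomp nMG Gz genM Gx.
  apply: commuteM; last exact: cy.
  by apply: commuteX; apply: commute_sym; apply: cz; apply: (subsetP sMG).
have [h Gh [_ zh]] := central_shift maxM Gz nMz ZGy My oy.
move: zh; rewrite /conjg (cz h Gh) mulKg => /eqP.
rewrite -{1}(mulg1 z) (inj_eq (mulgI z)) eq_sym -order_eq1 oy => p1.
by have := pr_p; rewrite (eqP p1).
Qed.

Lemma maximal_cent1 (M : {group gT}) z :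
  maximal M G -> z \in 'Z(G) -> #[z] = p ->
  exists2 h, h \in center_mod G z & 'C_G[h] = M.
Proof.
move=> maxM Zz oz; have Mz := central_in_maximal maxM Zz oz.
have nMG := p_maximal_normal pG maxM; have iM := p_maximal_index pG maxM.
have [_ [g Gg nMg]] := properP (maxgroupp maxM).
have genM := prime_quotient_cycle pr_p nMG iM Gg nMg.
have [h Gh [Mh gh]] := central_shift maxM Gg nMg Zz Mz oz.
have [Gz /centP cz] := setIP Zz.
have Gk k : k \in M -> k \in G by apply: subsetP (normal_sub nMG) k.
have gXh i : (g ^+ i) ^ h = g ^+ i * z ^+ i.
  by rewrite conjXg gh expgMn //; apply: commute_sym; apply: cz.
exists h.
  apply/center_modP => //; split=> // x Gx.
  have [i [k Mk ->]] := cyclic_ext_decomp nMG Gg genM Gx.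
  rewrite commgEl conjMg (Mh k Mk) gXh invMg !mulgA mulgKV -mulgA.
  have ck: commute (z ^+ i) k.
    by apply: commute_sym; apply: commuteX; apply: commute_sym; apply: cz; apply: Gk.
  by rewrite ck mulKg mem_cycle.
have sMC: M \subset 'C_G[h].
  apply/subsetP=> k Mk; rewrite inE Gk //; apply/cent1P.
  by apply/commgP/conjg_fixP; apply: Mh.
have [_ maxM'] := maxgroupP maxM; apply/esym/eqP; rewrite eqEsubset sMC /=.
apply/idPn => nC; case/negP: nC; rewrite (maxM' 'C_G[h]%G) //.
rewrite properEneq subsetIl andbT; apply/eqP=> CG.
have: g \in 'C_G[h] by rewrite CG.
case/setIP=> _ /cent1P/commgP/conjg_fixP; rewrite gh => /eqP.
rewrite -{2}(mulg1 g) (inj_eq (mulgI g)) -order_eq1 oz => p1.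
by have := pr_p; rewrite (eqP p1).
Qed.

(** Every maximal subgroup is the centraliser of an element of the relative
    centre, and Phi(G) is their intersection. *)
Lemma cent_center_mod z : z \in 'Z(G) -> #[z] = p ->
  'C_G(center_mod G z) \subset 'Phi(G).
Proof.
move=> Zz oz; apply/subsetP=> x /setIP[Gx /centP cx].
apply/bigcapP=> M; rewrite /maximal_eq => /predU1P[->//|maxM].
have [h Wh <-] := maximal_cent1 maxM Zz oz.
by rewrite inE Gx; apply/cent1P; apply: cx.
Qed.

Lemma leq_index_Phi z : z \in 'Z(G) -> #[z] = p ->
  #|G : 'Phi(G)| <= #|center_mod G z : 'Z(G)|.
Proof.
move=> Zz oz.
apply: leq_trans (index_cent_center_mod pr_p pG Zz oz (center_sub_mod Zz) (subxx _)).
by apply: dvdn_leq; [rewrite indexg_gt0 | apply: indexgS; apply: cent_center_mod].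
Qed.

End FrattiniInner.

Lemma exponent_mul (p : nat) (rT : finGroupType) (A B : {group rT}) :
  B \subset 'C(A) -> {in A, forall x, x ^+ p = 1} -> {in B, forall x, x ^+ p = 1} ->
  {in A <*> B, forall x, x ^+ p = 1}.
Proof.
move=> cAB eA eB x; rewrite cent_joinEr // => /mulsgP[a b Aa Bb ->].
rewrite expgMn ?(eA a Aa) ?(eB b Bb) ?mulg1 //.
by apply: commute_sym; apply: (centsP cAB).
Qed.

(** The lower bound for |W : 'Z(G)| meets the upper bound for subgroups of
    exponent p of H, and equality holds throughout. *)
Section PowerfulCentralQuotient.
Variables (gT : finGroupType) (p : nat) (G : {group gT}).
Hypotheses (pr_p : prime p) (pG : p.-group G) (nabG : ~~ abelian G).
Hypothesis powH : powerful p (G / 'Z(G)).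
Hypothesis innG : forall a : {perm gT},
  a \in Aut G -> #[a] = p -> {in 'Phi(G), a =1 id} -> a \in Inn G.

Local Notation W := (center_mod G).
Local Notation H := (G / 'Z(G)).
Let nZG : G \subset 'N('Z(G)). Proof. exact: normal_norm (center_normal G). Qed.

Lemma leq_index_Phi_quotient : #|H : 'Phi(H)| <= #|G : 'Phi(G)|.
Proof.
rewrite -(quotient_Phi pG nZG) dvdn_leq ?indexg_gt0 //.
by apply: index_quotient; rewrite (subset_trans _ nZG) ?subsetIl.
Qed.

Lemma center_mod_quotient z : z \in 'Z(G) -> #[z] = p ->
  [/\ W z / 'Z(G) \subset 'Z(H), {in W z / 'Z(G), forall x, x ^+ p = 1}
    & #|W z / 'Z(G)| = #|W z : 'Z(G)|].
Proof.
move=> Zz oz; have sWG := center_mod_sub Zz; have sWN := subset_trans sWG nZG.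
split; last exact: card_quotient.
- rewrite subsetI quotientS // quotient_cents2 // gen_subG.
  apply/subsetP=> _ /imset2P[w x Ww Gx ->].
  by rewrite -groupV invg_comm (comm_center_mod Zz).
move=> _ /morphimP[w Nw Ww ->]; rewrite -morphX //= coset_id //.
exact: (center_mod_exp Zz oz).
Qed.

Lemma center_mod_quotient_eq z : z \in 'Z(G) -> #[z] = p ->
  #|W z / 'Z(G)| = #|H : 'Phi(H)|.
Proof.
move=> Zz oz; have [sZ expE cE] := center_mod_quotient Zz oz.
apply/eqP; rewrite eqn_leq (powerful_exponent_bound pr_p powH) //=.
  by rewrite (leq_trans leq_index_Phi_quotient) // cE (leq_index_Phi pr_p pG nabG innG).
exact: subset_trans sZ (center_sub _).
Qed.

(** Adjoining such an x to W / 'Z(G), which is central and already of maximal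
    order among the subgroups of exponent p, cannot enlarge it. *)
Lemma root_center_mod z x : z \in 'Z(G) -> #[z] = p ->
  x \in G -> x ^+ p \in 'Z(G) -> x \in W z.
Proof.
move=> Zz oz Gx Zxp; have [sZ expE _] := center_mod_quotient Zz oz.
have Nx := subsetP nZG x Gx.
pose E := (W z / 'Z(G))%G; pose X := <[coset 'Z(G) x]>%G.
have sEH: E \subset H := subset_trans sZ (center_sub _).
have expX: {in X, forall u, u ^+ p = 1}.
  move=> _ /cycleP[i ->]; rewrite -expgM mulnC expgM -morphX //= coset_id //.
  by rewrite expg1n.
have sXH: X \subset H by rewrite cycle_subG mem_quotient.
have cXE: X \subset 'C(E).
  rewrite centsC; apply: subset_trans sZ _; apply: subset_trans (subsetIr _ _) _.
  exact: centS.
have le := powerful_exponent_bound pr_p powH (_ : E <*> X \subset H) (exponent_mul cXE expE expX).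
have {le}: #|E <*> X| <= #|E|.
  by rewrite /E /= (center_mod_quotient_eq Zz oz) le // join_subG sEH.
move=> leE; have: E :==: E <*> X by rewrite eqEcard joing_subl.
move/eqP=> defE; have: coset 'Z(G) x \in E.
  by rewrite defE (subsetP (joing_subr _ _)) // cycle_id.
move=> Ex; rewrite -[center_mod _ _](quotientGK (_ : 'Z(G) <| W z)).
  exact/morphpreP.
by rewrite /normal center_sub_mod // (subset_trans (center_mod_sub Zz)).
Qed.

(** Otherwise the two relative centres would meet in 'Z(G), and the product of
    their images in H would have exponent p and order |H : 'Phi(H)| ^ 2. *)
Lemma center_unique_prime_cycle z1 z2 : z1 \in 'Z(G) -> #[z1] = p ->
  z2 \in 'Z(G) -> #[z2] = p -> <[z1]> = <[z2]>.
Proof.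
move=> Zz1 oz1 Zz2 oz2; apply/eqP/negPn/negP=> neq.
have TIz: <[z1]> :&: <[z2]> = 1.
  apply: prime_TIg; first by rewrite -orderE oz1.
  apply: contra neq => s12; rewrite eqEcard s12 -!orderE oz1 oz2 leqnn //.
have [sZ1 expE1 cE1] := center_mod_quotient Zz1 oz1.
have [sZ2 expE2 cE2] := center_mod_quotient Zz2 oz2.
pose E1 := (W z1 / 'Z(G))%G; pose E2 := (W z2 / 'Z(G))%G.
have sE1H: E1 \subset H := subset_trans sZ1 (center_sub _).
have sE2H: E2 \subset H := subset_trans sZ2 (center_sub _).
have c21: E2 \subset 'C(E1).
  apply: subset_trans sZ2 _; apply: subset_trans (subsetIr _ _) _.
  exact: centS.
have TIE: E1 :&: E2 = 1.
  apply/trivgP; rewrite /= -quotientGI ?center_sub_mod //; last first.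
  apply/subsetP=> _ /morphimP[w Nw /setIP[W1 W2] ->].
  apply/set1gP/coset_id; have [Gw c1] := center_modP Zz1 _ W1.
  have [_ c2] := center_modP Zz2 _ W2; apply/setIP; split=> //.
  apply/centP=> x Gx; apply/commute_sym/commgP/eqP/set1gP.
  by rewrite -TIz inE c1 ?c2.
have := powerful_exponent_bound pr_p powH (_ : E1 <*> E2 \subset H) (exponent_mul c21 expE1 expE2).
rewrite join_subG sE1H sE2H => /(_ isT).
rewrite /= cent_joinEr // TI_cardMg //= (center_mod_quotient_eq Zz1 oz1).
rewrite (center_mod_quotient_eq Zz2 oz2) -[X in _ <= X]mul1n leq_pmul2r ?indexg_gt0 //.
rewrite leqNgt indexg_gt1 negbK => sHPhi.
have [H1 | ntH] := eqsVneq H 1.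
  case/negP: nabG; apply: (cyclic_factor_abelian (subxx 'Z(G))).
  by rewrite H1 cyclic1.
by have := Phi_proper ntH; rewrite properE sHPhi andbF.
Qed.

Lemma center_cyclic : cyclic 'Z(G).
Proof.
have pZ : p.-group 'Z(G) := pgroupS (center_sub G) pG.
rewrite abelian_rank1_cyclic ?center_abelian // (rank_pgroup pZ).
rewrite leqNgt; apply/negP=> /p_rank_geP[E /pnElemPcard[sEZ abE cE]].
have [z1 Ez1 ntz1]: exists2 z, z \in E & z != 1.
  by apply/trivgPn; rewrite -cardG_gt1 cE -(expn0 p) ltn_exp2l ?prime_gt1.
have oz z : z \in E -> z != 1 -> #[z] = p.
  by move=> Ez; apply: abelem_order_p abE Ez.
have: E \subset <[z1]>.
  apply/subsetP=> z Ez; have [->|nz] := eqVneq z 1; first exact: group1.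
  rewrite (@center_unique_prime_cycle z1 z) ?cycle_id ?(subsetP sEZ) ?oz //.
move/subset_leq_card; rewrite cE -orderE oz // leqNgt.
by rewrite -{1}(expn1 p) ltn_exp2l ?prime_gt1.
Qed.

End PowerfulCentralQuotient.

Section CenterModShift.
Variables (gT : finGroupType) (p : nat) (G : {group gT}) (z : gT).
Hypotheses (pr_p : prime p) (pG : p.-group G) (Zz : z \in 'Z(G)) (oz : #[z] = p).
Local Notation W := (center_mod G z).

Lemma comm_center_mod_exp w x : w \in W -> x \in G -> [~ w, x] ^+ p = 1.
Proof.
move=> Ww Gx; have [_ /(_ x Gx)] := center_modP Zz _ Ww.
rewrite -groupV invg_comm => /cycleP[i ->].
by rewrite -expgM mulnC expgM -oz expg_order expg1n.
Qed.

Lemma expMg_center_mod w x n : w \in W -> x \in G ->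
  (x * w) ^+ n = x ^+ n * w ^+ n * [~ w, x] ^+ 'C(n, 2).
Proof.
move=> Ww Gx; have [Gw _] := center_modP Zz _ Ww.
have Zc: [~ w, x] \in 'Z(G) by rewrite -groupV invg_comm (comm_center_mod Zz).
have [_ /centP cc] := setIP Zc.
by apply: expMg_Rmul; apply: commute_sym; apply: cc.
Qed.

Lemma center_mod_cent1 y : y \in W -> y \notin 'Z(G) ->
  [/\ maximal 'C_G[y] G, 'C_G[y] <| G, #|G : 'C_G[y]| = p & y \in 'Z('C_G[y])].
Proof.
move=> Wy nZy; have [Gy _] := center_modP Zz _ Wy.
have iM: #|G : 'C_G[y]| = p.
  have : p.-nat #|G : 'C_G[y]| by apply: pnat_dvd (dvdn_indexg _ _) pG.
  case/p_natP=> [[|k] ik].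
    case/negP: nZy; rewrite inE Gy; apply/centP=> x Gx; apply: commute_sym.
    have: G \subset 'C_G[y] by rewrite -indexg_eq1 ik.
    by case/subsetP/(_ x Gx)/setIP=> _ /cent1P/commute_sym.
  have := index_cent1_center_mod Zz oz Wy.
  rewrite ik -{2}(expn1 p) leq_exp2l ?prime_gt1 //.
  by case: k {ik} => // _; rewrite expn1.
have maxM: maximal 'C_G[y] G by apply: p_index_maximal; rewrite ?subsetIl ?iM.
split=> //; first exact: p_maximal_normal pG maxM.
apply/setIP; split; first by rewrite inE Gy cent1id.
by apply/centP=> k /setIP[_ /cent1P].
Qed.

End CenterModShift.

Section NoncentralShift.
Variables (gT : finGroupType) (p : nat) (G : {group gT}) (z : gT).
Hypotheses (pr_p : prime p) (pG : p.-group G) (nabG : ~~ abelian G).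
Hypothesis powH : powerful p (G / 'Z(G)).
Hypothesis innG : forall a : {perm gT},
  a \in Aut G -> #[a] = p -> {in 'Phi(G), a =1 id} -> a \in Inn G.
Hypotheses (Zz : z \in 'Z(G)) (oz : #[z] = p).
Local Notation W := (center_mod G z).

(** If a is conjugation by h then h ^ p is central, so h is in W and [g, h] = y
    is central. *)
Lemma noncentral_shift_noninner a g y : a \in Aut G -> #[a] = p ->
  g \in G -> a g = g * y -> y \notin 'Z(G) -> a \notin Inn G.
Proof.
move=> Aa oa Gg ag; apply: contra => /(InnP Aa)[h Gh ah].
have aX i x : x \in G -> (a ^+ i) x = x ^ (h ^+ i).
  move=> Gx; elim: i => [|i IHi]; first by rewrite perm1 conjg1.
  by rewrite expgSr permM IHi ah ?groupJ ?groupX // expgSr conjgM.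
have Zhp: h ^+ p \in 'Z(G).
  apply/setIP; split; first exact: groupX.
  apply/centP=> x Gx; apply: commute_sym; apply/commgP/conjg_fixP.
  by rewrite -aX // -oa expg_order perm1.
have Wh := root_center_mod pr_p pG nabG powH innG Zz oz Gh Zhp.
have := comm_center_mod Zz Wh Gg.
by rewrite commgEl -ah // ag mulKg.
Qed.

(** W / 'Z(G) has exponent p and is at least as large as G / Phi(G), which is
    not cyclic. *)
Lemma center_mod_noncyclic : ~~ cyclic W.
Proof.
apply: contra nabG => cW.
have [sZ expE cE] := center_mod_quotient Zz oz.
have [x Ex]: exists x, W / 'Z(G) = <[x]> by apply/cyclicP; apply: quotient_cyclic.
have leW: #|W / 'Z(G)| <= p.
  rewrite Ex -orderE dvdn_leq ?prime_gt0 // order_dvdn expE //.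
  by rewrite Ex cycle_id.
have := leq_trans (leq_index_Phi pr_p pG nabG innG Zz oz) (eq_leq (esym cE)).
move/leq_trans/(_ leW) => lePhi.
apply: cyclic_abelian; apply: Phi_quotient_cyclic.
have := quotient_pgroup 'Phi(G) pG; rewrite /pgroup.
rewrite card_quotient ?normal_norm ?Phi_normal //.
case/p_natP=> [[|[|k]]] iPhi.
- rewrite quotientS1 ?cyclic1 // -indexg_eq1.
  exact/eqP.
- by apply: prime_cyclic; rewrite card_quotient ?normal_norm ?Phi_normal // iPhi.
by move: lePhi; rewrite iPhi -{2}(expn1 p) leq_exp2l ?prime_gt1.
Qed.

(** The noncyclic group W has p-rank at least 2, because p-groups of rank 1 are
    cyclic if they are abelian or p is odd; but 'Z(G) has rank 1. *)
Lemma noncentral_prime_order : p != 2 \/ abelian W ->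
  exists2 y, y \in W & y \notin 'Z(G) /\ y ^+ p = 1.
Proof.
move=> podd; have sWG := center_mod_sub Zz; have pW := pgroupS sWG pG.
have pZ : p.-group 'Z(G) := pgroupS (center_sub G) pG.
have: 1 < 'r_p(W).
  rewrite ltnNge; apply: contra center_mod_noncyclic => r1.
  case: podd => [p2|abW]; last by rewrite abelian_rank1_cyclic // (rank_pgroup pW).
  rewrite (odd_pgroup_rank1_cyclic pW) //.
  have [k ->] := p_natP pW; rewrite oddX; apply/orP; right.
  by case: (even_prime pr_p) p2 => // ->.
case/p_rank_geP=> E /pnElemPcard[sEW abE cE].
have [y Ey nZy]: exists2 y, y \in E & y \notin 'Z(G).
  apply/subsetPn; apply/negP=> sEZ.
  have: 'r_p('Z(G)) <= 1.
    rewrite -(rank_pgroup pZ) -abelian_rank1_cyclic ?center_abelian //.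
    exact: (center_cyclic pr_p pG nabG powH innG).
  rewrite leqNgt => /negP; apply; apply/p_rank_geP; exists E; apply/pnElemP.
  by split=> //; rewrite cE pfactorK.
exists y; first exact: (subsetP sEW); split=> //.
by case/abelemP: abE => // _ ->.
Qed.

(** For odd p the shift g |-> g * y that fixes the maximal subgroup C_G(y) has
    order p and is not inner, although it fixes Phi(G). *)
Lemma frattini_inner_even : p = 2.
Proof.
apply/eqP; apply/idPn=> p_odd.
have [y Wy [nZy yp]] := noncentral_prime_order (or_introl p_odd).
have [maxM nMG iM ZMy] := center_mod_cent1 pr_p pG Zz oz Wy nZy.
have [_ [g Gg nMg]] := properP (maxgroupp maxM).
have genM := prime_quotient_cycle pr_p nMG iM Gg nMg.
have gyp: (g * y) ^+ #|G : 'C_G[y]| = g ^+ #|G : 'C_G[y]|.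
  rewrite iM (expMg_center_mod Zz) // yp mulg1.
  case/dvdnP: (odd_prime_dvd_bin2 pr_p p_odd) => k ->.
  by rewrite mulnC expgM (comm_center_mod_exp Zz oz) // expg1n mulg1.
have nty: y != 1 by apply: contraNneq nZy => ->; apply: group1.
have [a Aa [oa aM ag]] := cyclic_ext_Aut_prime nMG Gg genM ZMy gyp pr_p nty yp.
case/negP: (noncentral_shift_noninner Aa oa Gg ag nZy).
by apply: innG => // x Px; apply: aM; apply: subsetP Px; apply: Phi_sub_max.
Qed.

End NoncentralShift.

(** * Noninner involutions of 2-groups with cyclic centre *)

Section CyclicCenterTwoGroup.
Variables (gT : finGroupType) (G : {group gT}) (z : gT).
Hypotheses (pG : 2.-group G) (Zz : z \in 'Z(G)) (oz : #[z] = 2).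
Local Notation W := (center_mod G z).

Lemma comm_center_mod_two w x : w \in W -> x \in G -> [~ x, w] != 1 -> [~ x, w] = z.
Proof.
move=> Ww Gx; have [_ /(_ x Gx)] := center_modP Zz _ Ww.
by rewrite (cycle2g oz) => /set2P[->|//]; rewrite eqxx.
Qed.

(** For a generator c of the centre, write z = c ^ k, x ^ 2 = c ^ i and
    w ^ 2 = c ^ j with x and w in W not commuting; then
    (x * w) ^ 2 = c ^ (i + j + k), and one of i, j, i + j + k has the parity of
    k.  An element with square c ^ m and m = k modulo 2 becomes a square root
    of z on multiplication by a power of c. *)
Lemma nonabelian_center_mod_root : cyclic 'Z(G) -> ~~ abelian W ->
  exists t x, [/\ t \in W, t \notin 'Z(G), x \in W, [~ x, t] = z & t ^+ 2 = z].
Proof.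
case/cyclicP=> c defZ nabW.
have Zc: c \in 'Z(G) by rewrite defZ cycle_id.
have WZ d: d \in 'Z(G) -> d \in W by apply: (subsetP (center_sub_mod Zz)).
have GW w: w \in W -> w \in G by apply: (subsetP (center_mod_sub Zz)).
have sqW w: w \in W -> exists i, w ^+ 2 = c ^+ i.
  move=> Ww; have := center_mod_exp Zz oz Ww.
  by rewrite defZ => /cycleP.
have [k zk]: exists k, z = c ^+ k by apply/cycleP; rewrite -defZ.
have root u v m : u \in W -> v \in W -> [~ v, u] != 1 -> u ^+ 2 = c ^+ m ->
    odd m = odd k ->
  exists t x, [/\ t \in W, t \notin 'Z(G), x \in W, [~ x, t] = z & t ^+ 2 = z].
  move=> Wu Wv nvu u2 odd_mk; pose d := c ^- m * c ^+ ((k + m)./2).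
  have Zd: d \in 'Z(G) by rewrite groupM ?groupV ?groupX.
  have [Gd /centP cd] := setIP Zd.
  have nvt: [~ v, u * d] != 1.
    apply: contra nvu => /commgP cvt; apply/commgP.
    rewrite -(mulgK d u); apply: commuteM => //; apply: commuteV.
    by apply: commute_sym; apply: cd; apply: GW.
  have Wt: u * d \in W by apply: groupM => //; apply: WZ.
  exists (u * d), v; split=> //.
  - apply: contra nvt => /setIP[_ /centP/(_ v (GW v Wv)) ct].
    exact/commgP/commute_sym.
  - by apply: comm_center_mod_two => //; apply: GW.
  have cdd : commute (c ^- m) (c ^+ (k + m)./2).
    by apply: commute_sym; apply: commuteV; apply: commuteX2.
  rewrite expgMn; last by apply: commute_sym; apply: cd; apply: GW.
  rewrite u2 expgMn // expgVn -!expgM !muln2 mulgA.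
  have ->: ((k + m)./2).*2 = (k + m)%N.
    by rewrite -[RHS]odd_double_half oddD odd_mk addbb.
  rewrite -addnn expgD invMg mulKVg addnC expgD mulKg; exact: esym zk.
have /subsetPn[x Wx] := nabW; rewrite -sub_cent1 => /subsetPn[w Ww cxw].
have nwx: [~ w, x] != 1.
  by apply: contra cxw => /commgP cwx; apply/cent1P; apply: commute_sym.
have nxw: [~ x, w] != 1 by rewrite -invg_comm eq_invg1.
have [i x2] := sqW x Wx; have [j w2] := sqW w Ww.
have [oi|noi] := eqVneq (odd i) (odd k); first exact: (root x w i).
have [oj|noj] := eqVneq (odd j) (odd k); first exact: (root w x j).
apply: (root (x * w) w (i + j + k)%N) => //; first by rewrite groupM.
- apply: contra nwx => /commgP cwxw; apply/commgP.
  by rewrite -(mulgK w x); apply: commuteM => //; apply: commuteV.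
- rewrite (expMg_center_mod Zz) ?GW // x2 w2 binn expg1 !expgD; congr (_ * _).
  by rewrite -zk (@comm_center_mod_two x w) ?GW.
by rewrite !oddD; case: (odd i) (odd j) (odd k) noi noj => [] [] [].
Qed.

(** The shift b, x |-> x * t, that fixes C_G(t) is an automorphism, as
    (x * t) ^ 2 = x ^ 2, but b ^ 2 sends x to x * t ^ 2 = x * z.  Conjugation by
    x sends t to t * z, so composing it with b cancels this factor z. *)
Lemma nonabelian_center_mod_aut : cyclic 'Z(G) -> ~~ abelian W ->
  exists2 a, a \in Aut G & #[a] = 2 /\ a \notin Inn G.
Proof.
move=> cZ nabW; have [t [x [Wt nZt Wx cxt t2]]] := nonabelian_center_mod_root cZ nabW.
have pr2 : prime 2 by [].
have [maxM nKG iK ZKt] := center_mod_cent1 pr2 pG Zz oz Wt nZt.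
have [Gx _] := center_modP Zz _ Wx.
have Kt: t \in 'C_G[t] by case/setIP: ZKt.
have zz: z * z = 1 by rewrite -[z * z]expg2 -oz expg_order.
have ntz: z != 1 by rewrite -order_eq1 oz.
have nKx: x \notin 'C_G[t].
  by apply: contraNN ntz => /setIP[_ /cent1P cx]; rewrite -cxt; apply/commgP.
have genK := prime_quotient_cycle pr2 nKG iK Gx nKx.
have ctx: [~ t, x] = z.
  by rewrite -invg_comm cxt; apply/eqP; rewrite eq_invg_mul zz.
have xt2: (x * t) ^+ #|G : 'C_G[t]| = x ^+ #|G : 'C_G[t]|.
  by rewrite iK (expMg_center_mod Zz) // t2 binn expg1 ctx -mulgA zz mulg1.
have [b Ab [bK bx]] := cyclic_ext_Aut nKG Gx genK ZKt xt2.
pose a := conj_aut G x * b.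
have Ac: conj_aut G x \in Aut G by apply: Aut_aut.
have Aa: a \in Aut G by rewrite groupM.
have sKG := normal_sub nKG.
have aE u: u \in G -> a u = b (u ^ x).
  by move=> Gu; rewrite permM norm_conj_autE // (subsetP (normG G)).
have xx: x ^ x = x by rewrite /conjg mulKg.
have ax: a x = x * t by rewrite aE // xx.
have nt: t != 1 by apply: contraNneq nZt => ->; apply: group1.
have Zx2: x ^+ 2 \in 'Z(G) := center_mod_exp Zz oz Wx.
exists a => //; split.
  apply: nt_prime_order => //.
    apply: (cyclic_ext_Aut_eq nKG Gx genK) => [||k Kk|]; rewrite ?groupX ?group1 //.
      have Gk := subsetP sKG k Kk.
      have Kkx: k ^ x \in 'C_G[t] by rewrite memJ_norm // (subsetP (normal_norm nKG)).
      rewrite expgS expg1 permM perm1 (aE k Gk) (bK _ Kkx) aE ?(subsetP sKG) // bK.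
        rewrite -conjgM; apply/conjg_fixP/commgP; apply: commute_sym.
        by case/setIP: Zx2 => _ /centP; apply.
      by rewrite memJ_norm // (subsetP (normal_norm nKG)).
    have Gt := subsetP sKG t Kt.
    rewrite expgS expg1 permM perm1 ax aE ?groupM // conjMg xx.
    have Kz: z \in 'C_G[t].
      have [Gz /centP cz] := setIP Zz.
      by rewrite inE Gz; apply/cent1P; apply: cz.
    rewrite (conjg_mulR t) ctx (morphicP (Aut_morphic Ab)) //; last first.
      by rewrite (subsetP sKG) ?groupM.
    by rewrite bx bK ?groupM // -[x * t * _]mulgA (mulgA t) -[t * t]expg2 t2 zz mulg1.
  apply: contraNneq nt => a1; move: ax; rewrite a1 perm1 => /eqP.
  by rewrite -{1}(mulg1 x) (inj_eq (mulgI x)) eq_sym.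
apply: contra nZt => /(InnP Aa)[h Gh ah].
have := comm_center_mod Zz Wx Gh; rewrite -groupV invg_comm commgEl -ah //.
by rewrite ax mulKg.
Qed.

End CyclicCenterTwoGroup.

Section AbelianCenterMod.
Variables (gT : finGroupType) (G : {group gT}) (z : gT).
Hypotheses (pG : 2.-group G) (nabG : ~~ abelian G).
Hypothesis powH : powerful 2 (G / 'Z(G)).
Hypothesis innG : forall a : {perm gT},
  a \in Aut G -> #[a] = 2 -> {in 'Phi(G), a =1 id} -> a \in Inn G.
Hypotheses (Zz : z \in 'Z(G)) (oz : #[z] = 2).
Local Notation W := (center_mod G z).
Local Notation H := (G / 'Z(G)).
Hypothesis abW : abelian W.
Let pr2 : prime 2. Proof. by []. Qed.
Let nZG : G \subset 'N('Z(G)). Proof. exact: normal_norm (center_normal G). Qed.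
Let pH : 2.-group H. Proof. exact: quotient_pgroup. Qed.

Lemma center_mod_sub_Phi : W \subset 'Phi(G).
Proof.
apply: subset_trans (cent_center_mod pr2 pG nabG innG Zz oz).
by rewrite subsetI (center_mod_sub Zz).
Qed.

Lemma center_mod_square y : y \in W ->
  exists w c, [/\ w \in G, c \in 'Z(G) & y = w ^+ 2 * c].
Proof.
move=> Wy; have Py := subsetP center_mod_sub_Phi y Wy.
have Gy := subsetP (center_mod_sub Zz) y Wy.
have: coset 'Z(G) y \in 'Mho^1(H).
  by rewrite -(powerful_Phi powH) -(quotient_Phi pG nZG) mem_quotient.
case/(powerful_Mho1_root pr2 powH) => _ /morphimP[w Nw Gw ->] Ey.
exists w, (w ^- 2 * y); split=> //; last by rewrite mulKVg.
apply: coset_idr; first by rewrite (subsetP nZG) ?groupM ?groupV ?groupX.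
by rewrite morphM ?morphV ?morphX ?groupV ?groupX ?(subsetP nZG) //= Ey mulVg.
Qed.

(** If the image of g ^ 2 is in Mho^1(M / Z), then modulo Mho^1(Mho^1(H)), where
    H is abelian, it is the square of some m in M / Z.  So g / m is in the kernel
    of the squaring map on H, which by the case of equality in
    exponent_subgroup_bound is W Phi(G) / Z; this is contained in M / Z. *)
Lemma square_notin_Mho1 (M : {group gT}) g :
  maximal M G -> g \in G -> g \notin M ->
  coset 'Z(G) g ^+ 2 \notin 'Mho^1(M / 'Z(G)).
Proof.
move=> maxM Gg nMg; apply: contra nMg => g2.
have [sZ expE cE] := center_mod_quotient Zz oz.
have [_ embH] := andP (etrans (esym (powerful_embedded 2 H)) powH).
have sPM : 'Phi(G) \subset M := Phi_sub_max maxM.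
have [sMG _] := andP (p_maximal_normal pG maxM).
set N2 := 'Mho^1('Mho^1(H))%G.
have nN2 : H \subset 'N(N2) by apply: normal_norm; do 2!apply: gFnormal_trans.
have H'N2: H^`(1) \subset N2.
  case/andP: embH => _ embH; apply: subset_trans embH _.
  exact: (Mho2_sub_Mho11 pH).
have sMH : M / 'Z(G) \subset H by apply: quotientS.
have nN2M := subset_trans sMH nN2.
have Hg : coset 'Z(G) g \in H by apply: mem_quotient.
have: coset N2 (coset 'Z(G) g ^+ 2) \in 'Mho^1(M / 'Z(G) / N2).
  by rewrite /quotient -morphim_Mho //; apply: mem_quotient.
have abQ: abelian (M / 'Z(G) / N2).
  by apply: abelianS (quotientS _ sMH) _; rewrite sub_der1_abelian.
rewrite (MhoEabelian 1 (quotient_pgroup _ (quotient_pgroup _ (pgroupS sMG pG))) abQ).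
case/imsetP=> _ /morphimP[m Nm Mm ->]; rewrite expn1 => Em.
have Hm := subsetP sMH m Mm.
have: (coset 'Z(G) g * m^-1) ^+ 2 \in N2.
  apply: coset_idr; first by rewrite groupX // groupM ?groupV ?(subsetP nN2).
  have abH : abelian (H / N2) by rewrite sub_der1_abelian.
  have Nc := subsetP nN2 _ Hg.
  rewrite morphX ?groupM ?groupV // morphM ?groupV // morphV //=.
  rewrite expgMn; last first.
    by apply: (centsP abH); rewrite ?groupV mem_quotient.
  by rewrite expgVn -Em morphX //= mulgV.
move/(powerful_exponent_extremal pr2 powH (subset_trans sZ (center_sub _)) expE).
rewrite (center_mod_quotient_eq pr2 pG nabG powH innG Zz oz) => /(_ erefl).
rewrite groupM ?groupV // => /(_ isT).
rewrite -(quotient_Phi pG nZG) => /mulsgP[e f Ee Ff Def].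
have sPM' := quotientS 'Z(G) sPM.
have Me: e \in M / 'Z(G).
  by apply: (subsetP sPM'); apply: subsetP Ee; apply: quotientS; apply: center_mod_sub_Phi.
have: coset 'Z(G) g \in M / 'Z(G).
  by rewrite -(groupMr _ (groupVr Mm)) Def groupM // (subsetP sPM').
move=> Mg; have sZM: 'Z(G) \subset M.
  apply: subset_trans (center_sub_mod Zz) (subset_trans center_mod_sub_Phi sPM).
rewrite -[gval M](quotientGK (_ : 'Z(G) <| M)); last first.
  by rewrite /normal sZM (subset_trans sMG).
by apply/morphpreP; split; first exact: (subsetP nZG).
Qed.

(** Take y of order 2 in W and g outside M = C_G(y).  The subgroup K is maximal
    in M, contains 'Z(G) and y but not g ^ 2.  Both requirements on K can be
    met because modulo 'Z(G), Phi(M) consists of products of squares of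
    elements of M: y is such a square, and g ^ 2 is not such a product. *)
Lemma abelian_center_mod_aut :
  exists2 a, a \in Aut G & #[a] = 2 /\ a \notin Inn G.
Proof.
have [y Wy [nZy y2]] := noncentral_prime_order pr2 pG nabG powH innG Zz oz (or_intror abW).
have [maxM nMG iM ZMy] := center_mod_cent1 pr2 pG Zz oz Wy nZy.
have [_ [g Gg nMg]] := properP (maxgroupp maxM).
pose M := 'C_G[y]%G; have sMG : M \subset G := subsetIl _ _.
have Gy := subsetP (center_mod_sub Zz) y Wy.
have sPM : 'Phi(G) \subset M := Phi_sub_max maxM.
have sZM: 'Z(G) \subset M.
  apply: subset_trans (center_sub_mod Zz) (subset_trans center_mod_sub_Phi sPM).
have sMH : M / 'Z(G) \subset H by apply: quotientS.
have iMH: #|H : M / 'Z(G)| = 2.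
  rewrite index_quotient_eq //; apply: subset_trans (subsetIr _ _) sZM.
have pMb : 2.-group (M / 'Z(G)) := pgroupS sMH pH.
have PhiH : 'Mho^1(H) \subset M / 'Z(G).
  by rewrite -(powerful_Phi powH) -(quotient_Phi pG nZG) quotientS.
have H'M : H^`(1) \subset 'Mho^1(M / 'Z(G)).
  have [_ /andP[_ embH]] := andP (etrans (esym (powerful_embedded 2 H)) powH).
  apply: subset_trans embH _; apply: subset_trans (Mho2_sub_Mho11 pH) _.
  exact: MhoS.
have PhiM : 'Phi(M / 'Z(G)) = 'Mho^1(M / 'Z(G)).
  rewrite (Phi_joing pMb); apply/joing_idPr; apply: subset_trans H'M.
  exact: dergS.
(* Since y = w ^ 2 * c commutes with w, the root w lies in M. *)
have ySq: coset 'Z(G) y \in 'Mho^1(M / 'Z(G)).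
  have [w [c [Gw Zc Dy]]] := center_mod_square Wy.
  have Mw: w \in M.
    rewrite inE Gw; apply/cent1P; rewrite Dy; apply: commuteM.
      exact: commuteX.
    by case/setIP: Zc => _ /centP cc; apply: commute_sym; apply: cc.
  rewrite Dy morphM ?groupX ?(subsetP nZG) //=; last by case/setIP: Zc.
  rewrite (coset_id Zc) mulg1 morphX ?(subsetP nZG) //=.
  by have := Mho_mem_power 1 pMb (mem_quotient _ Mw); apply.
have Mg2: coset 'Z(G) g ^+ 2 \in M / 'Z(G).
  by apply: (subsetP PhiH); apply: (Mho_mem_power 1 pH); apply: mem_quotient.
have [Kb maxKb nKb]: exists2 Kb : {group coset_of 'Z(G)},
    maximal Kb (M / 'Z(G)) & coset 'Z(G) g ^+ 2 \notin Kb.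
  have := square_notin_Mho1 maxM Gg nMg; rewrite -PhiM => nPg.
  case: (pickP (fun Kb : {group coset_of 'Z(G)} =>
    maximal Kb (M / 'Z(G)) && (coset 'Z(G) g ^+ 2 \notin Kb))) => [Kb /andP[]|noK].
    by exists Kb.
  case/negP: nPg; apply/bigcapP=> Kb; rewrite /maximal_eq => /predU1P[->//|maxKb].
  by have := noK Kb; rewrite maxKb /= => /negbFE.
have sKM := proper_sub (maxgroupp maxKb).
have H'K : H^`(1) \subset Kb.
  by apply: subset_trans H'M _; rewrite -PhiM; apply: Phi_sub_max.
have nKbH : Kb <| H by apply: sub_der1_normal => //; apply: subset_trans sMH.
pose K := (coset 'Z(G) @*^-1 Kb)%G.
have nKG : K <| G by rewrite -[gval G](quotientGK (center_normal G)) cosetpre_normal.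
have sZK: 'Z(G) \subset K by apply: sub_cosetpre.
have defK : K / 'Z(G) = Kb by apply: cosetpreK.
have memK x : x \in G -> (x \in K) = (coset 'Z(G) x \in Kb).
  by move=> Gx; apply/morphpreP/idP => [[]|Kx] //; split; first exact: (subsetP nZG).
have Ky : y \in K by rewrite memK // (subsetP (Phi_sub_max maxKb)) ?PhiM.
have sKMG : K \subset M.
  rewrite -[gval M](quotientGK (_ : 'Z(G) <| M)) ?morphpreS //.
  by rewrite /normal sZM (subset_trans sMG).
have iK : #|G : K| = 4.
  rewrite -(index_quotient_eq _ (normal_sub nKG) nZG) ?defK.
    rewrite -(Lagrange_index sMH sKM) iMH.
    by rewrite (p_maximal_index pMb maxKb).
  exact: subset_trans (subsetIr _ _) sZK.
have Ng := subsetP (normal_norm nKG) g Gg.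
have oQ: #|G / K| = 4 by rewrite card_quotient ?normal_norm.
have genK : G / K = <[coset K g]>.
  apply/eqP; rewrite eq_sym eqEcard cycle_subG mem_quotient //= oQ -orderE.
  have: #[coset K g] %| 2 ^ 2 by rewrite -[(2 ^ 2)%N]oQ order_dvdG ?mem_quotient.
  case/(dvdn_pfactor _ _ pr2) => [[|[|[|m]]]] // _ og.
    case/negP: nKb; rewrite -morphX ?(subsetP nZG) //= -(memK _ (groupX 2 Gg)).
    apply: coset_idr; first exact: groupX.
    by rewrite morphX //= (eqP (_ : coset K g == 1)) ?expg1n // -order_eq1 og.
    case/negP: nKb; rewrite -morphX ?(subsetP nZG) //= -(memK _ (groupX 2 Gg)).
    apply: coset_idr; first exact: groupX.
    by rewrite morphX //= -[2]og expg_order.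
  by rewrite og.
have ZKy : y \in 'Z(K).
  rewrite inE Ky; apply/centP=> k Kk.
  by have /setIP[_ /cent1P] := subsetP sKMG k Kk; apply: commute_sym.
(* (g * y) ^ 4 = g ^ 4 * y ^ 4 * [y, g] ^ 6. *)
have gy4 : (g * y) ^+ #|G : K| = g ^+ #|G : K|.
  rewrite iK (expMg_center_mod Zz) // (expgM y 2 2) y2 expg1n mulg1.
  by rewrite (expgM _ 2 3) (comm_center_mod_exp Zz oz) // expg1n mulg1.
have nty: y != 1 by apply: contraNneq nZy => ->; apply: group1.
have [a Aa [oa aK ag]] := cyclic_ext_Aut_prime nKG Gg genK ZKy gy4 pr2 nty y2.
exists a => //; split=> //.
exact: (noncentral_shift_noninner pr2 pG nabG powH innG Zz oz Aa oa Gg ag nZy).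
Qed.

End AbelianCenterMod.

Lemma powerful_center_two_aut (gT : finGroupType) (G : {group gT}) :
  2.-group G -> ~~ abelian G -> powerful 2 (G / 'Z(G)) ->
  (forall a : {perm gT},
    a \in Aut G -> #[a] = 2 -> {in 'Phi(G), a =1 id} -> a \in Inn G) ->
  exists2 a, a \in Aut G & #[a] = 2 /\ a \notin Inn G.
Proof.
move=> pG nabG powH innG.
have ntG: G :!=: 1 by apply: contraNneq nabG => ->; apply: abelian1.
have ntZ: 'Z(G) != 1 by rewrite center_nil_eq1 ?(pgroup_nil pG).
have [_ pdvZ _] := pgroup_pdiv (pgroupS (center_sub G) pG) ntZ.
have [z Zz oz] := Cauchy (isT : prime 2) pdvZ.
have [abW|nabW] := boolP (abelian (center_mod G z)).
  exact: (abelian_center_mod_aut pG nabG powH innG Zz oz abW).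
apply: (nonabelian_center_mod_aut pG Zz oz _ nabW).
exact: (center_cyclic _ pG nabG powH innG).
Qed.

(** * A group of order 64 *)

(** The pair (m, c) stands for the affine map t |-> m * t + c of the integers
    modulo 16; as for permutations, the left factor of a product acts first. *)
Definition affine_mul (u v : nat * nat) := ((u.1 * v.1) %% 16, (v.1 * u.2 + v.2) %% 16)%N.
Definition affine_exp u n := iter n (affine_mul u) (1%N, 0).

(** The code of x ^ i * y ^ j for x : t |-> t + 1 and y : t |-> 5 * t. *)
Definition affine_word i j := affine_mul (affine_exp (1%N, 1%N) i) (affine_exp (5, 0) j).

(** Conditions on the images U = x ^ i * y ^ j and V = x ^ k * y ^ l of x and y
    under an automorphism of order 2 that fixes the Frattini subgroup: U and V
    have the same squares as x and y, they satisfy the relation x * y =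
    y * x ^ 5, and a second application sends x to itself.  Unlike
    the strict boolean conjunction, the conditionals stop at the first
    condition that fails. *)
Definition affine_image_ok i j k l :=
  let U := affine_word i j in let V := affine_word k l in
  if affine_mul U U != (1%N, 2) then false else
  if affine_mul V V != (9, 0) then false else
  if affine_mul U V != affine_mul V (affine_exp U 5) then false else
  affine_mul (affine_exp U i) (affine_exp V j) == (1%N, 1%N).

Definition affine_conjugating i j k l r s :=
  let h := affine_word r s in
  (affine_mul (1%N, 1%N) h == affine_mul h (affine_word i j))
  && (affine_mul (5, 0) h == affine_mul h (affine_word k l)).

(** The last condition of affine_image_ok matters: U = x ^ 5 * y ^ 2 and V = y
    satisfy the others, but U is not conjugate to x. *)
Lemma affine_check :
  all (fun i => all (fun j => all (fun k => all (fun l =>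
    if affine_image_ok i j k l then
      has (fun r => has (affine_conjugating i j k l r) (iota 0 4)) (iota 0 16)
    else true)
    (iota 0 4)) (iota 0 16)) (iota 0 4)) (iota 0 16).
Proof. by vm_compute. Qed.

Section AffinePermutations.
Import GRing.Theory.
Local Open Scope ring_scope.

Definition affine_by (u : {perm 'Z_16}) (c : nat * nat) :=
  forall t : 'Z_16, u t = c.1%:R * t + c.2%:R.

Lemma affine_by_mul u v c d :
  affine_by u c -> affine_by v d -> affine_by (u * v)%g (affine_mul c d).
Proof.
move=> uc vd t; rewrite permM uc vd /= !Zp_nat_mod //.
by rewrite natrM natrD natrM mulrDr mulrA addrA (mulrC c.1%:R).
Qed.

Lemma affine_by_exp u c n : affine_by u c -> affine_by (u ^+ n)%g (affine_exp c n).
Proof.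
move=> uc; elim: n => [|n IHn]; first by move=> t; rewrite perm1 mul1r addr0.
rewrite expgS; exact: affine_by_mul.
Qed.

Lemma affine_by_inj u v c : affine_by u c -> affine_by v c -> u = v.
Proof. by move=> uc vc; apply/permP=> t; rewrite uc vc. Qed.

Lemma affine_by_eq u c d :
  affine_by u c -> affine_by u d -> (c.1 = d.1 %[mod 16])%N /\ (c.2 = d.2 %[mod 16])%N.
Proof.
have modE m n : m%:R = n%:R :> 'Z_16 -> (m = n %[mod 16])%N.
  by move/(congr1 val); rewrite /= !val_Zp_nat.
move=> uc ud; have e2: c.2%:R = d.2%:R :> 'Z_16.
  by have := uc 0; rewrite ud !mulr0 !add0r.
split; last exact: modE.
by apply: modE; have := uc 1; rewrite ud !mulr1 e2 => /addIr.
Qed.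

Definition translation : {perm 'Z_16} := perm (@addrI 'Z_16 1).
(* 5 * 13 = 1 modulo 16. *)
Lemma dilation_inj : injective (fun t : 'Z_16 => 5%:R * t).
Proof.
apply: (can_inj (g := fun t => 13%:R * t)) => t.
by rewrite mulrA -natrM -Zp_nat_mod // mul1r.
Qed.
Definition dilation : {perm 'Z_16} := perm dilation_inj.

Lemma translationE : affine_by translation (1%N, 1%N).
Proof. by move=> t; rewrite permE mul1r addrC. Qed.
Lemma dilationE : affine_by dilation (5, 0)%N.
Proof. by move=> t; rewrite permE addr0. Qed.

End AffinePermutations.

Section Modular64.
Local Notation x := translation.
Local Notation y := dilation.

Lemma affine_wordE i j : affine_by (x ^+ i * y ^+ j) (affine_word i j).
Proof.
by apply: affine_by_mul; apply: affine_by_exp; [exact: translationE | exact: dilationE].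
Qed.

Lemma translation_order : x ^+ 16 = 1.
Proof.
apply: (affine_by_inj (affine_by_exp 16 translationE)).
by move=> t; rewrite perm1 GRing.mul1r GRing.addr0.
Qed.

Lemma dilation_order : y ^+ 4 = 1.
Proof.
apply: (affine_by_inj (affine_by_exp 4 dilationE)).
by move=> t; rewrite perm1 GRing.mul1r GRing.addr0.
Qed.

Lemma translation_conj : x * y = y * x ^+ 5.
Proof.
apply: (affine_by_inj (affine_by_mul translationE dilationE)).
exact: affine_by_mul dilationE (affine_by_exp 5 translationE).
Qed.

Definition modular64 := <[x]> <*> <[y]>.
Local Notation G := [group of modular64].

Lemma translationJ : x ^ y = x ^+ 5.
Proof. by rewrite /conjg translation_conj mulKg. Qed.

Lemma mem_modular64 u : u \in G -> exists i j, [/\ i < 16, j < 4 & u = x ^+ i * y ^+ j].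
Proof.
rewrite /= /modular64 norm_joinEr ?norms_cycle ?translationJ ?mem_cycle //.
case/mulsgP=> _ _ /cycleP[i ->] /cycleP[j ->] ->; exists (i %% 16), (j %% 4).
rewrite !ltn_mod; split=> //.
by rewrite !expg_mod ?translation_order ?dilation_order.
Qed.

Lemma modular64_gen : x \in G /\ y \in G.
Proof.
by split; rewrite -cycle_subG ?joing_subl ?joing_subr.
Qed.

Lemma affine_by_normal u c d : affine_by u c -> affine_by u d ->
  c.1 < 16 -> c.2 < 16 -> d.1 < 16 -> d.2 < 16 -> c = d.
Proof.
move=> uc ud c1 c2 d1 d2; have [] := affine_by_eq uc ud; rewrite !modn_small //.
by case: c d {uc ud c1 c2 d1 d2} => c1 c2 [d1 d2] /= -> ->.
Qed.

Lemma affine_mul_normal c d : (affine_mul c d).1 < 16 /\ (affine_mul c d).2 < 16.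
Proof. by rewrite !ltn_mod. Qed.

Lemma affine_mul_eq u c c' d d' v : affine_by u (affine_mul c c') ->
  affine_by v (affine_mul d d') -> u = v -> affine_mul c c' = affine_mul d d'.
Proof.
move=> uc vd uv; rewrite -uv in vd.
have [c1 c2] := affine_mul_normal c c'; have [d1 d2] := affine_mul_normal d d'.
exact: affine_by_normal uc vd c1 c2 d1 d2.
Qed.

Lemma modular64_pgroup : 2.-group G.
Proof.
rewrite /= /modular64 norm_joinEr ?norms_cycle ?translationJ ?mem_cycle //.
rewrite pgroupM /pgroup -!orderE.
rewrite (pnat_dvd (_ : #[x] %| 2 ^ 4)) ?pnatX ?order_dvdn ?translation_order //=.
by rewrite (pnat_dvd (_ : #[y] %| 2 ^ 2)) ?pnatX ?order_dvdn ?dilation_order.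
Qed.

Lemma translation_comm : [~ x, y] = x ^+ 4.
Proof. by rewrite commgEl translationJ (expgS x 4) mulKg. Qed.

Lemma modular64_comm_central : x ^+ 4 \in 'C(G).
Proof.
rewrite /= /modular64 centY inE !cent_cycle; apply/andP; split; apply/cent1P.
  by apply: commute_sym; apply: commuteX.
apply/commgP/conjg_fixP; rewrite conjXg translationJ -expgM.
by rewrite -(expg_mod _ translation_order).
Qed.

Lemma modular64_der1 : G^`(1) = <[x ^+ 4]>.
Proof.
by rewrite /= der1_joing_cycles translation_comm // modular64_comm_central.
Qed.

Lemma translation4_neq1 : x ^+ 4 != 1.
Proof.
apply/eqP=> x4; have : affine_by 1 (1%N, 0%N).
  by move=> t; rewrite perm1 GRing.mul1r GRing.addr0.
move/affine_by_eq/(_ (_ : affine_by 1 (affine_exp (1%N, 1%N) 4))).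
by case=> //; rewrite -x4; apply: affine_by_exp translationE.
Qed.

Lemma modular64_powerful : powerful 2 G.
Proof.
have [Gx Gy] := modular64_gen.
rewrite /powerful modular64_pgroup modular64_der1 /= cycle_subG.
by apply: mem_gen; apply/imsetP; exists x.
Qed.

Lemma modular64_nil_class : nil_class G = 2.
Proof.
apply/eqP; rewrite eqn_leq nil_class2 ltnNge nil_class1 modular64_der1 cycle_subG.
have [Gx _] := modular64_gen.
rewrite inE groupX //= modular64_comm_central /=.
apply/negP=> abG; have /derG1P := abG; rewrite modular64_der1 => /eqP.
by rewrite cycle_eq1 (negbTE translation4_neq1).
Qed.

Lemma modular64_inner (a : {perm {perm 'Z_16}}) :
  a \in Aut G -> #[a] = 2 -> fixes_elementwise a 'Phi(G) -> a \in Inn G.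
Proof.
move=> Aa oa fixa; have [Gx Gy] := modular64_gen.
have aM u v : u \in G -> v \in G -> a (u * v) = a u * a v.
  exact: (morphicP (Aut_morphic Aa)).
have aX u n : u \in G -> a (u ^+ n) = a u ^+ n.
  by move=> Gu; rewrite -!(autmE Aa) morphX.
have Phi2 u : u \in G -> a (u ^+ 2) = u ^+ 2.
  move=> Gu; apply: fixa; rewrite (Phi_joing modular64_pgroup).
  apply: (subsetP (joing_subr _ _)).
  exact: (Mho_mem_power 1 modular64_pgroup Gu).
have aG u : u \in G -> a u \in G by move=> Gu; rewrite Aut_closed.
have [i [j [lt_i lt_j ax]]] := mem_modular64 (aG x Gx).
have [k [l [lt_k lt_l ay]]] := mem_modular64 (aG y Gy).
have bx : affine_by (a x) (affine_word i j) by rewrite ax; apply: affine_wordE.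
have b_y : affine_by (a y) (affine_word k l) by rewrite ay; apply: affine_wordE.
have memI m n : m < n -> m \in iota 0 n by rewrite mem_iota.
have /allP/(_ i (memI _ _ lt_i))/allP/(_ j (memI _ _ lt_j)) := affine_check.
move=> /allP/(_ k (memI _ _ lt_k))/allP/(_ l (memI _ _ lt_l)).
rewrite ifT.
  case/hasP=> r _ /hasP[s _ /andP[/eqP hx /eqP hy]].
  have hb := affine_wordE r s; set h := x ^+ r * y ^+ s in hb.
  have Gh : h \in G by rewrite groupM ?groupX.
  have hax : a x = x ^ h.
    apply: (mulgI h); rewrite /conjg mulKVg.
    apply: (affine_by_inj (affine_by_mul hb bx)).
    by rewrite -hx; apply: affine_by_mul translationE hb.
  have hay : a y = y ^ h.
    apply: (mulgI h); rewrite /conjg mulKVg.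
    apply: (affine_by_inj (affine_by_mul hb b_y)).
    by rewrite -hy; apply: affine_by_mul dilationE hb.
  apply/(InnP Aa); exists h => // u /mem_modular64[m [n [_ _ ->]]].
  by rewrite aM ?groupX // !aX // hax hay conjMg !conjXg.
have x2 : affine_by (a x ^+ 2) (affine_mul (1%N, 1%N) (1%N, 1%N)).
  by rewrite -aX // Phi2 // expgS; apply: affine_by_mul; exact: translationE.
have y2 : affine_by (a y ^+ 2) (affine_mul (5, 0)%N (5, 0)%N).
  by rewrite -aX // Phi2 // expgS; apply: affine_by_mul; exact: dilationE.
rewrite /affine_image_ok.
rewrite (affine_mul_eq (affine_by_mul bx bx) x2 (erefl _)) /=.
rewrite (affine_mul_eq (affine_by_mul b_y b_y) y2 (erefl _)) /=.
rewrite (affine_mul_eq (affine_by_mul bx b_y) (affine_by_mul b_y (affine_by_exp 5 bx))) ?eqxx /=.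
  apply/eqP.
  have aax : a x ^+ i * a y ^+ j = x.
    have a2 : a * a = 1 by apply/eqP; rewrite -expg2 -order_dvdn oa.
    by rewrite -!aX // -aM ?groupX // -ax -permM a2 perm1.
  have baax := affine_by_mul (affine_by_exp i bx) (affine_by_exp j b_y).
  apply: (@affine_mul_eq _ _ _ (1%N, 1%N) (1%N, 0%N) _ baax _ aax).
  exact: translationE.
by rewrite -aX // -!aM ?groupX // translation_conj.
Qed.

End Modular64.

(** * The theorem *)

(** A characteristic subgroup of order 2 has a single nontrivial element. *)
Lemma Aut_fixes_char_order2 (gT : finGroupType) (G U : {group gT}) a :
  U \char G -> #|U| = 2 -> a \in Aut G -> fixes_elementwise a U.
Proof.
move=> chU oU Aa x Ux; have sUG := char_sub chU.
have [u ou defU] : exists2 u, #[u] = 2 & U :=: <[u]>.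
  have [|u Uu ou] := @Cauchy _ 2 U isT; first by rewrite oU.
  by exists u => //; apply/eqP; rewrite eq_sym eqEcard cycle_subG Uu -orderE ou oU.
have Uax : a x \in U.
  case/charP: chU => _ /(_ (autm_morphism Aa) (injm_autm Aa) (im_autm Aa)) imU.
  by rewrite -imU -(autmE Aa) mem_morphim ?(subsetP sUG).
move: Ux Uax; rewrite defU (cycle2g ou) => /set2P Dx /set2P Dax.
have a1 : a 1 = 1 by rewrite -(autmE Aa) morph1.
case: Dx Dax => -> [] // au; have := perm_inj (etrans au (esym a1)).
by move=> u1; rewrite u1 a1.
Qed.

Theorem theorem2p6 :
  (forall (p : nat) (gT : finGroupType) (G : {group gT}),
     prime p -> p.-group G -> ~~ abelian G -> powerful p (G / 'Z(G)) ->
     (2 < p \/ ~~ cyclic 'Z(G) ->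
        exists a : {perm gT},
          [/\ a \in Aut G, a \notin Inn G, #[a] = p
            & fixes_elementwise a 'Phi(G)])
     /\
     (p = 2 ->
        exists a : {perm gT},
          [/\ a \in Aut G, a \notin Inn G, #[a] = 2
            & fixes_elementwise a 'Phi(G)
              \/ fixes_elementwise a 'Ohm_1('Z(G))]))
  /\
  (exists (gT : finGroupType) (G : {group gT}),
     [/\ powerful 2 G, nil_class G = 2
       & forall a : {perm gT},
           a \in Aut G -> #[a] = 2 -> fixes_elementwise a 'Phi(G) ->
           a \in Inn G]).
Proof.
split; last first.
  exists {perm 'Z_16}, [group of modular64].
  by split; [exact: modular64_powerful | exact: modular64_nil_class |
             exact: modular64_inner].
move=> p gT G pr_p pG nabG powH.
have [[a [Aa nIa oa fixa]] | innG] :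
    (exists a : {perm gT}, [/\ a \in Aut G, a \notin Inn G, #[a] = p
                             & fixes_elementwise a 'Phi(G)])
    \/ (forall a : {perm gT},
          a \in Aut G -> #[a] = p -> {in 'Phi(G), a =1 id} -> a \in Inn G).
  case: (pickP (fun a : {perm gT} => [&& a \in Aut G, a \notin Inn G, #[a] == p
                & [forall x in 'Phi(G), a x == x]])) => [a | noa].
    case/and4P=> Aa nIa /eqP oa /forall_inP fixa; left; exists a; split=> //.
    by move=> x Px; apply/eqP; apply: fixa.
  right=> a Aa oa fixa; have := noa a; rewrite Aa oa eqxx /=.
  case: (a \in Inn G) => //= /forall_inP[] x Px.
  by rewrite fixa.
- split=> [_ | p2]; first by exists a; split.
  by exists a; split=> //; [rewrite oa | left].
have cZ := center_cyclic pr_p pG nabG powH innG.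
split=> [[p_gt2 | ncZ] | p2]; last first.
- rewrite {p}p2 in pr_p pG powH innG.
  have [a Aa [oa nIa]] := powerful_center_two_aut pG nabG powH innG.
  exists a; split=> //; right; apply: (@Aut_fixes_char_order2 _ G) => //.
    exact: char_trans (Ohm_char 1 _) (center_char G).
  apply: Ohm1_cyclic_pgroup_prime cZ (pgroupS (center_sub G) pG) _.
  rewrite center_nil_eq1 ?(pgroup_nil pG) //.
  by apply: contraNneq nabG => ->; apply: abelian1.
- by rewrite cZ in ncZ.
have ntG: G :!=: 1 by apply: contraNneq nabG => ->; apply: abelian1.
have ntZ: 'Z(G) != 1 by rewrite center_nil_eq1 ?(pgroup_nil pG).
have [_ pdvZ _] := pgroup_pdiv (pgroupS (center_sub G) pG) ntZ.
have [z Zz oz] := Cauchy pr_p pdvZ.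
have p2 := frattini_inner_even pr_p pG nabG powH innG Zz oz.
by rewrite p2 in p_gt2.
Qed.
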